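(* Let $\mu,\nu,q\in\mathscr{P}_2(\mathbb{R}^d)$. Assume that $\mu\preceq_{\mathrm{c}}\nu$ and that $q$ does not give mass to small sets. Then the primal problem \[ P^{q}(\mu,\nu)\coloneqq\sup_{\pi\in\mathsf{MT}(\mu,\nu)}\int \mathrm{MCov}(\pi_x,q)\,\mu(dx) \] is uniquely attained (there is exactly one $\hat\pi\in\mathsf{MT}(\mu,\nu)$ achieving the supremum), its value $P^q(\mu,\nu)$ is finite, and \[ P^q(\mu,\nu)=D^{q}(\mu,\nu)\coloneqq\inf_{\substack{\psi\in L^1(\nu),\\ \psi \text{ convex}}}\Big(\int\psi\,d\nu-\int(\psi^{\ast}\star q)^{\ast}\,d\mu\Big). \]
   Context: $\mathscr{P}_2(\mathbb{R}^d)$ is the set of Borel probability measures on $\mathbb{R}^d$ with finite second moment. $\mu\preceq_{\mathrm{c}}\nu$ (convex order) means $\int f\,d\mu\le\int f\,d\nu$ for all convex $f:\mathbb{R}^d\to\mathbb{R}$. A measure $q$ does not give mass to small sets if $q(A)=0$ for every measurable $A\subseteq\mathbb{R}^d$ of Hausdorff dimension at most $d-1$. For $\rho,\varrho\in\mathscr{P}_2(\mathbb{R}^d)$, $\mathrm{MCov}(\rho,\varrho)\coloneqq\sup_{\tilde\pi\in\mathsf{Cpl}(\rho,\varrho)}\int\langle y,z\rangle\,\tilde\pi(dy,dz)$, where $\mathsf{Cpl}(\rho,\varrho)$ is the set of couplings of $\rho$ and $\varrho$. $\mathsf{MT}(\mu,\nu)$ is the set of martingale transports: couplings $\pi\in\mathsf{Cpl}(\mu,\nu)$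 with disintegration $\pi(dx,dy)=\pi_x(dy)\mu(dx)$ such that $\int y\,\pi_x(dy)=x$ for $\mu$-a.e. $x$. For $\psi:\mathbb{R}^d\to(-\infty,+\infty]$, $\psi^\ast(x)\coloneqq\sup_{y}(\langle x,y\rangle-\psi(y))$ is the convex conjugate. For a function $f$ and a probability measure $\varrho$, $(f\star\varrho)(y)\coloneqq\int f(y+z)\,\varrho(dz)$. *)

(* Defs.v *)
From HB Require Import structures.
From mathcomp Require Import all_boot all_order all_algebra.
From mathcomp Require Import all_classical all_reals all_analysis.
From mathcomp Require Import measurable_realfun.
Set Implicit Arguments. Unset Strict Implicit. Unset Printing Implicit Defensive.
Import Order.TTheory GRing.Theory Num.Theory.
Import numFieldNormedType.Exports.
Local Open Scope classical_set_scope.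
Local Open Scope ring_scope.

Section Defs.
Variables (R : realType) (d : nat).

(** R^d as row vectors, with the Borel sigma-algebra (generated by open sets
    of the product topology, i.e. the Euclidean topology). *)
Definition Rd : measurableType _ := g_sigma_algebraType (@open 'rV[R]_d).

Definition inner (x y : 'rV[R]_d) : R := \sum_(i < d) x ord0 i * y ord0 i.
Definition sqnorm (x : 'rV[R]_d) : R := inner x x.
Definition edist (x y : 'rV[R]_d) : R := Num.sqrt (sqnorm (x - y)).

Definition finite_second_moment (rho : probability Rd R) : Prop :=
  (\int[rho]_x (sqnorm x)%:E < +oo)%E.

Definition convex_fun (f : 'rV[R]_d -> R) : Prop :=
  forall (x y : 'rV[R]_d) (t : R), 0 <= t <= 1 ->
    f (t *: x + (1 - t) *: y) <= t * f x + (1 - t) * f y.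

Definition convex_efun (f : 'rV[R]_d -> \bar R) : Prop :=
  (forall x, f x != -oo)%E /\
  forall (x y : 'rV[R]_d) (t : R), 0 < t < 1 ->
    (f (t *: x + (1 - t) *: y)%R <= t%:E * f x + (1 - t)%:E * f y)%E.

Definition convex_order (mu nu : probability Rd R) : Prop :=
  forall f : 'rV[R]_d -> R, convex_fun f ->
    (\int[mu]_x (f x)%:E <= \int[nu]_x (f x)%:E)%E.

Definition diam (U : set 'rV[R]_d) : \bar R :=
  ereal_sup [set (edist x y)%:E | x in U & y in U].

Definition diam_pow (s : R) (U : set 'rV[R]_d) : \bar R :=
  if `[< U !=set0 >] then
    (match diam U with r%:E => (r `^ s)%:E | _ => +oo end)%E
  else 0%E.

Definition hausdorff_pre (s delta : R) (A : set 'rV[R]_d) : \bar R :=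
  ereal_inf [set (\sum_(n <oo) diam_pow s (U n))%E |
             U in [set U : nat -> set 'rV[R]_d |
                    A `<=` \bigcup_n U n /\ forall n, (diam (U n) <= delta%:E)%E]].

(** H^s(A) = lim_{delta -> 0+} H^s_delta(A) = sup_{delta > 0} H^s_delta(A) *)
Definition hausdorff_measure (s : R) (A : set 'rV[R]_d) : \bar R :=
  ereal_sup [set hausdorff_pre s delta A | delta in [set delta : R | 0 < delta]].

Definition hausdorff_dim (A : set 'rV[R]_d) : \bar R :=
  ereal_inf [set s%:E | s in [set s : R | 0 <= s /\ hausdorff_measure s A = 0%E]].

Definition no_mass_small_sets (q : probability Rd R) : Prop :=
  forall A : set Rd, measurable A ->
    (hausdorff_dim A <= (d%:R - 1)%:E)%E -> q A = 0%E.

Definition coupling (rho vrho : probability Rd R)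
    (pi : probability (Rd * Rd)%type R) : Prop :=
  (forall A : set Rd, measurable A -> pi (A `*` setT) = rho A) /\
  (forall B : set Rd, measurable B -> pi (setT `*` B) = vrho B).

Definition MCov (rho vrho : probability Rd R) : \bar R :=
  ereal_sup [set (\int[pi]_yz (inner yz.1 yz.2)%:E)%E |
             pi in [set pi | coupling rho vrho pi]].

Definition disintegration (mu : probability Rd R)
    (pi : probability (Rd * Rd)%type R) (k : Rd -> probability Rd R) : Prop :=
  (forall B : set Rd, measurable B -> measurable_fun setT (fun x => k x B)) /\
  (forall A B : set Rd, measurable A -> measurable B ->
     pi (A `*` B) = (\int[mu]_(x in A) k x B)%E).

Definition martingale_kernel (mu : probability Rd R)
    (k : Rd -> probability Rd R) : Prop :=
  {ae mu, forall x : Rd, forall i : 'I_d,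
     (\int[k x]_y ((y : 'rV[R]_d) ord0 i)%:E)%E = ((x : 'rV[R]_d) ord0 i)%:E}.

Definition MT_with (mu nu : probability Rd R)
    (pi : probability (Rd * Rd)%type R) (k : Rd -> probability Rd R) : Prop :=
  coupling mu nu pi /\ disintegration mu pi k /\ martingale_kernel mu k.

Definition MT (mu nu : probability Rd R) (pi : probability (Rd * Rd)%type R) :=
  exists k, MT_with mu nu pi k.

Definition primal_obj (mu q : probability Rd R) (k : Rd -> probability Rd R) :=
  (\int[mu]_x MCov (k x) q)%E.

Definition Pq (mu nu q : probability Rd R) : \bar R :=
  ereal_sup [set primal_obj mu q k | k in
     [set k | exists pi, MT_with mu nu pi k]].

Definition conj (f : 'rV[R]_d -> \bar R) (x : 'rV[R]_d) : \bar R :=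
  ereal_sup [set ((inner x y)%:E - f y)%E | y in [set: 'rV[R]_d]].

Definition conv (f : 'rV[R]_d -> \bar R) (vrho : probability Rd R)
    (y : 'rV[R]_d) : \bar R :=
  (\int[vrho]_z f (y + (z : 'rV[R]_d))%R)%E.

Definition dual_admissible (nu : probability Rd R) (psi : 'rV[R]_d -> \bar R) :=
  convex_efun psi /\ nu.-integrable (setT : set Rd) psi.

Definition Dq (mu nu q : probability Rd R) : \bar R :=
  ereal_inf [set (\int[nu]_y psi y - \int[mu]_x conj (conv (conj psi) q) x)%E |
             psi in [set psi | dual_admissible nu psi]].

End Defs.

(* Main.v *)
(** With X ~ mu, Z ~ q independent of X, and Y ~ nu, the problem is to maximise
    E<Y, Z> subject to E[Y | X] = X, or more generally E<Y - X, b(X)> = 0 for every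
    bounded Borel b. This is a linear program. Its dual asks for phi, chi, b with
    <y, z> <= phi(x, z) + chi(y) + <x - y, b(x)> at minimal cost E phi + E chi; every
    such triple yields the convex function
    psi(y) = sup_(x, z) <y, z + b(x)> - <x, b(x)> - phi(x, z) <= chi(y), whose dual cost
    is at most E phi + E chi.

    Instead of compactness, the M. Riesz extension theorem supplies an optimal plan
    which is merely a finitely additive expectation: a positive functional extending
    (phi, chi, b) |-> E phi + E chi and whose value at <y, z> is the dual value.
    Under such a plan the slacks of a minimising sequence are small, which forces
    Y to be monotone in Z given X up to small errors. Hence the set of (x, z) from which
    both y_i <= a and y_i >= c (with a < c) are possible has sections satisfying a cone
    condition; these have dimension at most d - 1 and are q-null. So Y = T(X, Z) almost
    surely for a Borel map T, the law of (X, T(X, Z)) is a countably additive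
    martingale transport, and it attains the dual value.

    For uniqueness, an optimal transport also comes from an optimal functional; the
    average of the two functionals is optimal, hence carried by one graph, and the two
    transports coincide. *)

Require Import Defs.
From HB Require Import structures.
From mathcomp Require Import all_boot all_order all_algebra.
From mathcomp Require Import all_classical all_reals all_analysis.
From mathcomp Require Import measurable_realfun ring lra.
Import Order.TTheory GRing.Theory Num.Theory.
Import numFieldNormedType.Exports.
Local Open Scope classical_set_scope.
Local Open Scope ring_scope.

Set Implicit Arguments. Unset Strict Implicit. Unset Printing Implicit Defensive.

(** * Positive extensions of linear functionals *)

(** Every conditional law of Y is coupled with the same [q], whence the fixed product law of (X, Z).
    The obstacle behind the whole construction is that a finitely additive plan may charge a
    countable union of null events. Each passage to the limit is therefore made on an event of (X,
    Z) alone or of Y alone, where the plan agrees with a countably additive measure. For the same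
    reason, being carried by the graph of T means that Y is within e of T(X, Z) off a null event,
    for each e > 0 separately. The minimising sequence is chosen with gap [4^-n]: Markov's
    inequality at the threshold [2^-n] then leaves a summable bound. In the uniqueness part, gluing
    optimal couplings of [k x] and [q] into one plan would call for a choice measurable in x. A
    second linear program, whose constraints contain the joint law of (X, Y), yields such a
    functional through the extension theorem instead. *)

Section RieszExtension.
Context {R : realType} {S : Type}.
Implicit Types (G U : set ((S -> R) * R)) (u h c : S -> R).

(* A linear functional on a subspace is given by its graph [G]: [G (u, v)] reads
   [u] is in the domain and has value [v]. *)
Definition linear_graph G := forall (k : R) u v u' v', G (u, v) -> G (u', v') ->
  G (fun s => k * u s + u' s, k * v + v').

Definition positive_graph G := forall u v, G (u, v) -> (forall s, 0 <= u s) -> 0 <= v.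

Definition dominated G h := exists u v, G (u, v) /\ forall s, `|h s| <= u s.

Definition adjoin G h (r : R) : set ((S -> R) * R) :=
  [set p | exists t u v, G (u, v) /\ p = (fun s => t * h s + u s, t * r + v)].

Lemma linear_graphZ G k u v : linear_graph G -> G (fun=> 0, 0) -> G (u, v) ->
  G (fun s => k * u s, k * v).
Proof.
move=> lG G0 Guv; have := lG k _ _ _ _ Guv G0.
by rewrite addr0; congr (G (_, _)); apply/funext => s; rewrite addr0.
Qed.

Lemma linear_graphB G u v u' v' : linear_graph G -> G (u, v) -> G (u', v') ->
  G (fun s => u' s - u s, v' - v).
Proof.
move=> lG Guv Guv'; have := lG (-1) _ _ _ _ Guv Guv'.
by congr (G (_, _)); [apply/funext => s|]; rewrite mulN1r addrC.
Qed.

Lemma linear_graph_le G u v u' v' : linear_graph G -> positive_graph G ->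
  G (u, v) -> G (u', v') -> (forall s, u s <= u' s) -> v <= v'.
Proof.
move=> lG pG Guv Guv' uu'; rewrite -subr_ge0.
by apply: (pG _ _ (linear_graphB lG Guv Guv')) => s; rewrite subr_ge0.
Qed.

Lemma linear_graph_uniq G u v v' : linear_graph G -> positive_graph G ->
  G (u, v) -> G (u, v') -> v = v'.
Proof.
by move=> lG pG H H'; apply/eqP; rewrite eq_le; apply/andP; split;
  [apply: (linear_graph_le lG pG H H')|apply: (linear_graph_le lG pG H' H)].
Qed.

Lemma adjoin_linear G h r : linear_graph G -> linear_graph (adjoin G h r).
Proof.
move=> lG k _ _ _ _ [t [w [x [Gw [-> ->]]]]] [t' [w' [x' [Gw' [-> ->]]]]].
exists (k * t + t'), (fun s => k * w s + w' s), (k * x + x'); split; first exact: lG.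
by congr pair; [apply/funext => s|]; ring.
Qed.

(** Dividing by [t], nonnegativity of [t * h + u] says that [- t^-1 * u] lies below [h] if [t > 0]
    and above it if [t < 0]; the two hypotheses compare its value with [r]. *)
Lemma adjoin_positive G h r : linear_graph G -> G (fun=> 0, 0) -> positive_graph G ->
  (forall u v, G (u, v) -> (forall s, u s <= h s) -> v <= r) ->
  (forall u v, G (u, v) -> (forall s, h s <= u s) -> r <= v) ->
  positive_graph (adjoin G h r).
Proof.
move=> lG G0 pG lo up _ _ [t [u [v [Guv [-> ->]]]]] ge0.
have Gt := linear_graphZ (- t^-1) lG G0 Guv.
have [t0|t0|t0] := ltgtP t 0.
- have /up : forall s, h s <= - t^-1 * u s.
    by move=> s; rewrite mulNr -mulrN mulrC ler_ndivlMr//; have := ge0 s; lra.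
  by move=> /(_ _ Gt); rewrite mulNr -mulrN mulrC ler_ndivlMr//; lra.
- have /lo : forall s, - t^-1 * u s <= h s.
    by move=> s; rewrite mulNr -mulrN mulrC ler_pdivrMr//; have := ge0 s; lra.
  by move=> /(_ _ Gt); rewrite mulNr -mulrN mulrC ler_pdivrMr//; lra.
- by subst t; rewrite mul0r add0r; apply: (pG _ _ Guv) => s; have := ge0 s; rewrite mul0r add0r.
Qed.

Lemma sub_adjoin G h r : G `<=` adjoin G h r.
Proof.
move=> [u v] Guv; exists 0, u, v; split => //; congr pair; last by rewrite mul0r add0r.
by apply/funext => s; rewrite mul0r add0r.
Qed.

Lemma adjoin_mem G h r : G (fun=> 0, 0) -> adjoin G h r (h, r).
Proof.
move=> G0; exists 1, (fun=> 0), 0; split => //; congr pair; last by rewrite mul1r addr0.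
by apply/funext => s; rewrite mul1r addr0.
Qed.

Definition upper_values G h := [set v | exists u, G (u, v) /\ forall s, h s <= u s].

Lemma has_inf_upper_values G h : linear_graph G -> G (fun=> 0, 0) -> positive_graph G ->
  dominated G h -> has_inf (upper_values G h).
Proof.
move=> lG G0 pG [u [v [Guv hu]]]; split.
  by exists v, u; split => // s; rewrite (le_trans (ler_norm _) (hu s)).
exists (- 1 * v) => w [u' [Gu'w hu']].
apply: (linear_graph_le lG pG (linear_graphZ (-1) lG G0 Guv) Gu'w) => s.
by rewrite mulN1r (le_trans _ (hu' s))// lerNl (le_trans _ (hu s))// -normrN ler_norm.
Qed.

Lemma adjoin_inf_positive G h : linear_graph G -> G (fun=> 0, 0) -> positive_graph G ->
  dominated G h -> positive_graph (adjoin G h (inf (upper_values G h))).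
Proof.
move=> lG G0 pG dh; have [ne lb] := has_inf_upper_values lG G0 pG dh.
apply: adjoin_positive => // u v Guv uh.
- apply: lb_le_inf => // w [u' [Gu'w hu']].
  by apply: (linear_graph_le lG pG Guv Gu'w) => s; exact: le_trans (uh s) (hu' s).
- by apply: ge_inf => //; exists u.
Qed.

Definition positive_extension U (L : (S -> R) -> R) :=
  [/\ (forall k h1 h2, dominated U h1 -> dominated U h2 ->
        L (fun s => k * h1 s + h2 s) = k * L h1 + L h2),
      (forall h, dominated U h -> (forall s, 0 <= h s) -> 0 <= L h)
    & (forall u v, U (u, v) -> L u = v)].

Lemma maximal_positive_graph U : linear_graph U -> U (fun=> 0, 0) -> positive_graph U ->
  exists G, [/\ U `<=` G, linear_graph G, positive_graph G
     & forall h, dominated U h -> exists r, G (h, r)].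
Proof.
move=> lU U0 pU.
(* The condition is put on the union with [U], so that the empty chain, whose union is empty,
   satisfies it. *)
pose P G := linear_graph (G `|` U) /\ positive_graph (G `|` U).
have [F FP Ftot|A [[lA pA] Amax]] := @Zorn_bigcup _ P.
  split.
    move=> k u v u' v' [[G1 FG1 G1u]|Uu] [[G2 FG2 G2u]|Uu'].
    - have [G12|G21] := Ftot _ _ FG1 FG2.
        have [l _] := FP _ FG2; have [] := l k u v u' v'.
        + by left; apply: G12.
        + by left.
        + by move=> ?; left; exists G2.
        + by right.
      have [l _] := FP _ FG1; have [] := l k u v u' v'.
        + by left.
        + by left; apply: G21.
        + by move=> ?; left; exists G1.
        + by right.
    - have [l _] := FP _ FG1; have [] := l k u v u' v'; [by left|by right| |by right].
      by move=> ?; left; exists G1.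
    - have [l _] := FP _ FG2; have [] := l k u v u' v'; [by right|by left| |by right].
      by move=> ?; left; exists G2.
    - by right; apply: lU.
  move=> u v [[G FG Gu]|Uu].
    by have [_ p] := FP _ FG; apply: p; left.
  exact: pU.
pose G := A `|` U; have G0 : G (fun=> 0, 0) by right.
exists G; split => //; first by move=> x Ux; right.
move=> h [w [x [Uw hw]]].
have dh : dominated G h by exists w, x; split => //; right.
apply: contrapT => Nh.
pose r := inf (upper_values G h).
have := Amax (adjoin G h r); apply.
  split; last first.
    move=> /(_ (h, r) (adjoin_mem _ _ G0)) Ahr; apply: Nh; exists r; by left.
  by move=> y Ay; apply: sub_adjoin; left.
rewrite /P; have -> : adjoin G h r `|` U = adjoin G h r.
  by apply/setUidPl => y Uy; apply: sub_adjoin; right.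
by split; [exact: adjoin_linear|exact: adjoin_inf_positive].
Qed.

(** Adjoining [c] before Zorn's lemma, at the infimum of its upper values, fixes the value of every
    further extension at [c]. This is the absence of a duality gap for the program [U] with cost
    [c]. *)
Lemma riesz_extension U c : linear_graph U -> U (fun=> 0, 0) -> positive_graph U ->
  dominated U c ->
  exists L, positive_extension U L /\
    forall e, 0 < e -> exists u v, [/\ U (u, v), forall s, c s <= u s & v <= L c + e].
Proof.
move=> lU U0 pU dc; pose r := inf (upper_values U c).
have lV : linear_graph (adjoin U c r) by exact: adjoin_linear.
have pV : positive_graph (adjoin U c r) by exact: adjoin_inf_positive.
have UV : U `<=` adjoin U c r by exact: sub_adjoin.
have [G [VG lG pG domG]] := maximal_positive_graph lV (UV _ U0) pV.
(* Functions without a value in [G] get the default [0]. *)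
pose L h := xget 0 [set r | G (h, r)].
have LP h v : G (h, v) -> L h = v.
  by move=> Ghv; apply: xget_unique => // w /(linear_graph_uniq lG pG Ghv).
have domU h : dominated U h -> G (h, L h).
  move=> [u [v [Uuv hu]]]; have [|w Ghw] := domG h.
    by exists u, v; split => //; exact: UV.
  by rewrite (LP _ _ Ghw).
exists L; split; first split.
- by move=> k h1 h2 /domU G1 /domU G2; apply: LP; exact: lG.
- by move=> h /domU Gh; exact: pG Gh.
- by move=> u v Uuv; apply/LP/VG/UV.
- move=> e e0; have hi := has_inf_upper_values lU U0 pU dc.
  have [v [u [Uuv cu]] vr] := inf_adherent e0 hi.
  exists u, v; split => //.
  rewrite (LP c r); first exact: ltW.
  exact/VG/adjoin_mem.
Qed.

End RieszExtension.

(** * Borel sets and Lipschitz graphs in R^d *)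

Section EuclideanBorel.
Context {R : realType} {d : nat}.
Notation V := 'rV[R]_d.

Definition box (f : {ffun 'I_d -> rat * rat}) : set V :=
  [set x | forall i, ratr (f i).1 < x ord0 i < ratr (f i).2].

Lemma open_bigcup_box (A : set V) : open A ->
  A = \bigcup_(f in [set f | box f `<=` A]) box f.
Proof.
move=> oA; apply/seteqP; split => [x Ax|x [f /= fA]]; last exact: fA.
move: oA; rewrite openE => /(_ _ Ax) [P Px PA].
have /choice[g gP] : forall i : 'I_d, exists p : rat * rat,
    ratr p.1 < x ord0 i < ratr p.2 /\
    (forall t : R, ratr p.1 < t < ratr p.2 -> P ord0 i t).
  move=> i; have := Px ord0 i => /nbhs_ballP[e /= e0 eP].
  have /rat_in_itvoo[a] : x ord0 i - e < x ord0 i by rewrite ltrBlDr ltrDl.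
  have /rat_in_itvoo[b] : x ord0 i < x ord0 i + e by rewrite ltrDl.
  rewrite !in_itv/= => /andP[xb be] /andP[ea ax].
  exists (a, b); rewrite /= ax xb; split => // t /andP[at_ tb].
  by apply: eP; rewrite /ball/= distrC ltr_distl; apply/andP; split;
    [exact: lt_trans at_|exact: lt_trans be].
exists [ffun i => g i] => /=.
  move=> y yb; apply: PA => i j; rewrite ord1.
  by apply: (gP j).2; have := yb j; rewrite ffunE.
by move=> i; rewrite ffunE; exact: (gP i).1.
Qed.

(** Open sets are countable unions of rational boxes, and the preimage of a box is a finite
    intersection of preimages under coordinates. *)
Lemma measurable_fun_Rd {dT} {T : measurableType dT} (f : T -> Rd R d) :
  (forall i, measurable_fun setT (fun t => (f t : V) ord0 i)) -> measurable_fun setT f.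
Proof.
move=> mf; apply: (@measurability _ _ T (Rd R d) setT f (@open V)) => // _ [A oA <-].
rewrite setTI (open_bigcup_box oA) preimage_bigcup.
have -> : \bigcup_(i in [set f0 | box f0 `<=` A]) f @^-1` box i =
   \bigcup_i (if `[< box i `<=` A >] then f @^-1` box i else set0).
  apply/seteqP; split => [x [b bA fb]|x [b _]].
    by exists b => //; rewrite asboolT.
  by case: asboolP => // bA fb; exists b.
apply: countable_bigcupT_measurable => // b; case: ifPn => // _.
have -> : f @^-1` box b = \bigcap_(i in [set: 'I_d])
    ((fun t => (f t : V) ord0 i) @^-1` `](ratr (b i).1), (ratr (b i).2)[%classic).
  apply/seteqP; split => [x fx i _|x fx i].
    by rewrite /= in_itv; exact: fx.
  by have := fx i I; rewrite /= in_itv.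
apply: fin_bigcap_measurable => [|i _]; first exact: finite_finset.
 rewrite -[X in measurable X]setTI.
exact: mf.
Qed.

Lemma measurable_Rd_open (A : set V) : open A -> measurable (A : set (Rd R d)).
Proof. by move=> oA; exact: sub_sigma_algebra. Qed.

Lemma open_continuous_preimage (f : V -> R) (A : set R) : continuous f -> open A -> open (f @^-1` A).
Proof. by move=> cf oA; apply: open_comp => // x _; exact: cf. Qed.

Lemma continuous_measurable_Rd (f : V -> R) : continuous f ->
  measurable_fun setT (f : Rd R d -> R).
Proof.
move=> cf; apply: (measurability _ (RGenOInfty.measurableE R)) => _ [_ [a ->] <-].
rewrite setTI; apply: measurable_Rd_open; exact: open_continuous_preimage.
Qed.

Lemma measurable_coord (i : 'I_d) :
  measurable_fun setT (fun x : Rd R d => (x : V) ord0 i).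
Proof. by apply: continuous_measurable_Rd => x; exact: coord_continuous. Qed.

Lemma measurable_coord_comp {dT} {T : measurableType dT} (f : T -> Rd R d) i :
  measurable_fun setT f -> measurable_fun setT (fun t => (f t : V) ord0 i).
Proof. by move=> mf; apply: (measurableT_comp (measurable_coord i)). Qed.

Lemma measurable_RdD {dT} {T : measurableType dT} (f g : T -> Rd R d) :
  measurable_fun setT f -> measurable_fun setT g ->
  measurable_fun setT (fun t => (f t : V) + (g t : V) : Rd R d).
Proof.
move=> mf mg; apply: measurable_fun_Rd => i.
under eq_fun do rewrite mxE.
by apply: measurable_funD; exact: measurable_coord_comp.
Qed.

Lemma measurable_inner {dT} {T : measurableType dT} (f g : T -> Rd R d) :
  measurable_fun setT f -> measurable_fun setT g ->
  measurable_fun setT (fun t => inner (f t) (g t)).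
Proof.
move=> mf mg; rewrite /inner; apply: measurable_sum => i.
by apply: measurable_funM; exact: measurable_coord_comp.
Qed.

Lemma continuous_inner (y : V) : continuous (fun x : V => inner x y).
Proof.
have ci i : continuous (fun x : V => x ord0 i * y ord0 i).
  by move=> x; apply: continuousM; [exact: coord_continuous|exact: cst_continuous].
move=> x; rewrite /inner; apply: (@cvg_big _ _ _ _ _ _ _ _ _ (fun i (x : V) => x ord0 i * y ord0 i)).
- by move=> ? ?; exact: add_continuous.
- exact: nbhs_filter.
- by move=> i _; exact: ci.
Qed.

(** The index set may be uncountable: a strict superlevel set is a union of open half-spaces, hence
    open. Measurability of conjugates and of [level1] rests on this. *)
Lemma measurable_sup_affine {I : Type} (B : set I) (a : I -> V) (f : I -> \bar R) :
  measurable_fun setT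
    (fun x : Rd R d => ereal_sup [set ((inner x (a i))%:E - f i)%E | i in B]).
Proof.
apply: (measurability _ (ErealGenOInfty.measurableE R)) => _ [_ [r ->] <-].
rewrite setTI; apply: measurable_Rd_open.
have -> : (fun x : V => ereal_sup [set ((inner x (a i))%:E - f i)%E | i in B]) @^-1` `]r%:E, +oo[%classic
  = \bigcup_(i in B) [set x : V | (r%:E < (inner x (a i))%:E - f i)%E].
  apply/seteqP; split => [x|x [i Bi /= rxi]]; rewrite /= in_itv/= andbT.
    by move=> /ereal_sup_gt[_ [i Bi <-] ?]; exists i.
  by apply: lt_le_trans rxi _; apply: ereal_sup_ubound; exists i.
apply: bigcup_open => i Bi; case: (f i) => [t||].
- have -> : [set x : V | (r%:E < (inner x (a i))%:E - t%:E)%E] =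
     (fun x => inner x (a i)) @^-1` `]r + t, +oo[%classic.
    by apply/seteqP; split => x /=; rewrite in_itv/= andbT lte_fin ltrBrDr.
  by apply: open_continuous_preimage => //; exact: continuous_inner.
- suff -> : [set x : V | (r%:E < (inner x (a i))%:E - +oo)%E] = set0 by exact: open0.
  by apply/seteqP; split.
- suff -> : [set x : V | (r%:E < (inner x (a i))%:E - -oo)%E] = setT by exact: openT.
  by apply/seteqP; split => // x _; rewrite /= ltry.
Qed.

Definition orthant (a : V) : set (Rd R d) := [set x | forall i, (x : V) ord0 i <= a ord0 i].

Lemma measurable_orthant a : measurable (orthant a).
Proof.
have -> : orthant a = \bigcap_(i in [set: 'I_d])
    ((fun x : Rd R d => (x : V) ord0 i) @^-1` `]-oo, a ord0 i]%classic).
  apply/seteqP; split => [x fx i _|x fx i].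
    by rewrite /= in_itv; exact: fx.
  by have := fx i I; rewrite /= in_itv.
apply: fin_bigcap_measurable => [|i _]; first exact: finite_finset.
 rewrite -[X in measurable X]setTI.
exact: measurable_coord.
Qed.

Lemma sigma_orthant : @measurable _ (Rd R d) `<=` <<s range orthant >>.
Proof.
pose T' : measurableType _ := g_sigma_algebraType (range orthant).
have : measurable_fun setT (id : T' -> Rd R d).
  apply: measurable_fun_Rd => i.
  apply: (measurability _ (RGenOInfty.measurableE R)) => _ [_ [a ->] <-].
  rewrite setTI.
  (* The half-space [x_i <= a] is the union over [n] of the orthants with corner [a] in direction
     [i] and [n] in all others. *)
  have -> : (fun t : T' => (t : V) ord0 i) @^-1` `]a, +oo[%classic =
    ~` (\bigcup_n (orthant (\row_j (if j == i then a else n%:R)) : set T')).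
    apply/seteqP; split => [x /=|x].
      rewrite in_itv/= andbT => ax [n _ /(_ i)]; rewrite mxE eqxx.
      by rewrite leNgt ax.
    move=> H; rewrite /= in_itv/= andbT ltNge; apply/negP => xa; apply: H.
    exists (Num.bound (\sum_j `|(x : V) ord0 j|)) => //= j; rewrite mxE; case: eqP => [->//|_].
    apply: le_trans (ltW (archi_boundP _)); last by apply: sumr_ge0.
    apply: (le_trans (ler_norm _)).
    by rewrite (bigD1 j)//= lerDl sumr_ge0.
  apply: measurableC; apply: bigcup_measurable => n _.
  by apply: sub_sigma_algebra; exists (\row_j (if j == i then a else n%:R)).
move=> mid A mA; have := mid measurableT A mA.
by rewrite setTI.
Qed.

(** Orthants are stable under intersection and generate the Borel sets: a finite measure is
    determined by its multivariate distribution function. *)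
Lemma orthant_measure_unique (m1 m2 : {measure set (Rd R d) -> \bar R}) :
  (m1 setT < +oo)%E -> (forall a, m1 (orthant a) = m2 (orthant a)) ->
  forall A, measurable A -> m1 A = m2 A.
Proof.
move=> m1oo m12 A mA.
apply: (@g_sigma_algebra_measure_unique _ _ _ (range orthant) _
   (fun n => orthant (const_mx n%:R))).
- by move=> _ [a _ <-]; exact: measurable_orthant.
- by move=> n; exists (const_mx n%:R).
- apply/seteqP; split => // x _; exists (Num.bound (\sum_j `|(x : V) ord0 j|)) => //= j.
  rewrite mxE; apply: le_trans (ltW (archi_boundP _)); last by apply: sumr_ge0.
  apply: (le_trans (ler_norm _)).
  by rewrite (bigD1 j)//= lerDl sumr_ge0.
- move=> _ _ [a _ <-] [b _ <-]; exists (\row_i Num.min (a ord0 i) (b ord0 i)) => //.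
  apply/seteqP; split => [x xab|x [xa xb] i].
    by split => i; have := xab i; rewrite mxE le_min => /andP[].
  by rewrite mxE le_min xa xb.
- by move=> _ [a _ <-]; exact: m12.
- move=> k; apply: le_lt_trans m1oo; apply: le_measure; rewrite ?inE//.
  exact: measurable_orthant.
- exact: sigma_orthant.
Qed.

End EuclideanBorel.

(** * Cone conditions and Hausdorff dimension *)

Section LipschitzGraphs.
Context {R : realType} {d : nat}.
Notation V := 'rV[R]_d.
Local Open Scope ring_scope.

(** [E] lies on the graph of a function expressing coordinate [i] through the other coordinates,
    [L]-Lipschitz for their l1 norm. *)
Definition cone_set (i : 'I_d) (L : R) (E : set V) := forall x y, E x -> E y ->
  `|x ord0 i - y ord0 i| <= L * \sum_(j < d | j != i) `|x ord0 j - y ord0 j|.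

Lemma edist_le_sum (x y : V) : Defs.edist x y <= \sum_j `|x ord0 j - y ord0 j|.
Proof.
have S0 : 0 <= \sum_j `|x ord0 j - y ord0 j| by apply: sumr_ge0.
rewrite /Defs.edist -(ger0_norm S0) -sqrtr_sqr ler_wsqrtr//.
rewrite /sqnorm /inner expr2 mulr_suml ler_sum// => j _.
rewrite !mxE -[X in X <= _]ger0_norm -?expr2 ?sqr_ge0// expr2 normrM.
by rewrite ler_wpM2l// (bigD1 j)//= lerDl sumr_ge0.
Qed.

Lemma diam_cone_cell i (L : R) (E : set V) (e : R) : 0 <= L -> 0 <= e -> cone_set i L E ->
  (forall x y j, E x -> E y -> j != i -> `|x ord0 j - y ord0 j| <= e) ->
  (diam E <= ((1 + L) * d%:R * e)%:E)%E.
Proof.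
move=> L0 e0 cE Ee; apply: ge_ereal_sup => _ [x Ex [y Ey <-]]; rewrite lee_fin.
apply: (le_trans (edist_le_sum x y)); rewrite (bigD1 i)//=.
have S : \sum_(j < d | j != i) `|x ord0 j - y ord0 j| <= d%:R * e.
  apply: (@le_trans _ _ (\sum_(j < d | j != i) e)); first by apply: ler_sum => j; exact: Ee.
  rewrite sumr_const -[leLHS]mulr_natl ler_wpM2r// ler_nat.
  by rewrite -[X in (_ <= X)%N]card_ord max_card.
have := cE _ _ Ex Ey; have := ler_wpM2l L0 S; lra.
Qed.

Lemma diam_pow_le (s b : R) (U : set V) : 0 < s -> (diam U <= b%:E)%E -> 0 <= b ->
  (diam_pow s U <= (b `^ s)%:E)%E.
Proof.
move=> s0 db b0; rewrite /diam_pow; case: asboolP => [[x Ux]|_]; last by rewrite lee_fin powR_ge0.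
have d0 : (0%:E <= diam U)%E.
  apply: ereal_sup_ubound; exists x => //; exists x => //.
  by rewrite /Defs.edist subrr /sqnorm /inner big1 ?sqrtr0// => j _; rewrite !mxE mul0r.
case: (diam U) db d0 => [r||]//.
by rewrite !lee_fin => rb r0; apply: ge0_ler_powR => //; exact: ltW.
Qed.

Lemma diam_pow_ge0 (s : R) (U : set V) : (0 <= diam_pow s U)%E.
Proof.
rewrite /diam_pow; case: ifP => // _.
by case: (diam U) => [r||]//; rewrite lee_fin powR_ge0.
Qed.

Lemma diam0 : diam (set0 : set V) = -oo%E.
Proof.
apply/eqP; rewrite -leeNy_eq; apply: ge_ereal_sup => _ [x []].
Qed.

Lemma hausdorff_pre_finite_cover (I : finType) (U : I -> set V) (s delta b : R) (E : set V) :
  0 < s -> 0 <= b <= delta -> E `<=` \bigcup_i U i -> (forall i, diam (U i) <= b%:E)%E ->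
  (hausdorff_pre s delta E <= (#|I|%:R * b `^ s)%:E)%E.
Proof.
move=> s0 /andP[b0 bd] EU Ub.
(* Padding with empty sets costs nothing: [diam set0] is [-oo], but [diam_pow] is [0] there. *)
pose W (n : nat) : set V := oapp (fun k : 'I_#|I| => U (enum_val k)) set0 (insub n).
have W0 n : (#|I| <= n)%N -> W n = set0 by move=> In; rewrite /W insubF// ltnNge In.
have Wb n : (diam (W n) <= b%:E)%E.
  by rewrite /W; case: insubP => [k _ _|_] /=; rewrite ?diam0 ?leNye//; exact: Ub.
apply: (@le_trans _ _ (\sum_(n <oo) diam_pow s (W n))%E).
  apply: ereal_inf_lbound; exists W => //; split.
    move=> x /EU[i _ Uix]; exists (enum_rank i) => //.
    by rewrite /W insubT//= => lt; rewrite (_ : Sub _ _ = enum_rank i) ?enum_rankK//; exact: val_inj.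
  by move=> n; apply: (le_trans (Wb n)); rewrite lee_fin.
apply: lime_le; first by apply: is_cvg_nneseries => n _ _; exact: diam_pow_ge0.
apply: nearW => n; apply: (@le_trans _ _ (\sum_(0 <= k < n) if (k < #|I|)%N then (b `^ s)%:E else 0)%E).
  apply: lee_sum => k _; case: ifPn => [_|]; first exact: diam_pow_le.
  by rewrite -leqNgt => /W0->; rewrite /diam_pow asboolF// => -[x].
rewrite -big_mkcond/= -EFin_sum_fine// lee_fin/=.
  rewrite (@eq_bigr _ _ _ _ _ _ _ (fun=> b `^ s))//.
  rewrite big_const_seq iter_addr_0 -[leLHS]mulr_natl ler_wpM2r ?powR_ge0// ler_nat.
  rewrite -size_filter; apply: (@leq_trans (size (iota 0 #|I|))); last by rewrite size_iota.
  apply: uniq_leq_size; first by rewrite filter_uniq// iota_uniq.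
  by move=> k; rewrite mem_filter => /andP[kI _]; rewrite mem_iota.
Qed.

Lemma exists_nat_powR_small (K t e : R) : 0 <= K -> 0 < t -> 0 < e ->
  exists N0 : nat, forall N : nat, (N0 <= N)%N -> K * N%:R `^ (- t) <= e.
Proof.
move=> K0 t0 e0; exists (Num.bound (((K + 1) / e) `^ (t^-1))).+1 => N N0N.
have Ke : 0 < (K + 1) / e by rewrite divr_gt0// ltr_wpDl.
have /ltW : ((K + 1) / e) `^ (t^-1) < N%:R.
  apply: (lt_le_trans (archi_boundP _)); first exact: powR_ge0.
  by rewrite ler_nat (leq_trans _ N0N).
move=> /(ge0_ler_powR (ltW t0)); rewrite !nnegrE powR_ge0 ler0n => /(_ isT isT).
rewrite -powRrM mulVf ?gt_eqF// powRr1 ?(ltW Ke)// => KN.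
rewrite powRN ler_pdivrMr ?(lt_le_trans Ke)//.
by have := KN; rewrite ler_pdivrMr// mulrC; lra.
Qed.

(* A cone set projects injectively along coordinate i, and a cell of side 1/N of
   the other d - 1 coordinates carries a piece of diameter O(1/N). *)
Lemma hausdorff_dim_cone i (L : R) (m : nat) (E : set V) : 0 <= L -> cone_set i L E ->
  (forall x j, E x -> `|x ord0 j| < m%:R) ->
  (hausdorff_dim E <= (d%:R - 1)%:E)%E.
Proof.
move=> L0 cE Em; apply/lee_addgt0Pr => e e0.
have d1 : (1 <= d)%N by exact: leq_ltn_trans (leq0n i) (ltn_ord i).
set s := d%:R - 1 + e.
have s0 : 0 < s by rewrite /s ltr_wpDl// subr_ge0 ler1n.
rewrite -EFinD -/s; apply: ereal_inf_lbound; exists s => //; split; first exact: ltW.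
suff H delta : 0 < delta -> hausdorff_pre s delta E = 0%E.
  apply/eqP; rewrite eq_le; apply/andP; split.
    by apply: ge_ereal_sup => _ [delta /= d0 <-]; rewrite H.
  by apply: ereal_sup_ubound; exists 1 => //=; rewrite ?H// ltr01.
move=> dl0; apply/eqP; rewrite eq_le; apply/andP; split; last first.
  apply: le_ereal_inf_tmp => _ [U _ <-]; apply: nneseries_ge0 => n _ _; exact: diam_pow_ge0.
apply/lee_addgt0Pr => eps eps0; rewrite add0e.
pose C := (1 + L) * d%:R.
have C0 : 0 <= C by rewrite mulr_ge0// addr_ge0.
(* There are [(2 m N) ^ (d - 1)] cells of diameter at most [C / N], so the cover has [s]-sum at most
   [K * N ^ (d - 1 - s) = K * N ^ (- e)]. *)
pose K := (2 * m%:R) ^+ d.-1 * C `^ s.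
have K0 : 0 <= K by rewrite mulr_ge0 ?exprn_ge0 ?powR_ge0// mulr_ge0.
have [N1 N1P] := exists_nat_powR_small K0 e0 eps0.
pose N := maxn N1 (Num.bound (C / delta)).+1.
have N0 : (0 < N)%N by rewrite leq_max orbT.
have N0' : 0 < N%:R :> R by rewrite ltr0n.
have Cd : C / N%:R <= delta.
  rewrite ler_pdivrMr// mulrC -ler_pdivrMr//; apply: ltW.
  apply: (lt_le_trans (archi_boundP _)); first by rewrite divr_ge0// ltW.
  by rewrite ler_nat /N leq_max leqnSn orbT.
pose M := (2 * m * N)%N.
pose cell (k : {ffun 'I_d.-1 -> 'I_M}) : set V := [set x | E x /\ forall j,
   (k j)%:R <= (x ord0 (lift i j) + m%:R) * N%:R < (k j).+1%:R].
apply: (@le_trans _ _ ((#|{ffun 'I_d.-1 -> 'I_M}|%:R * (C / N%:R) `^ s)%:E)).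
  apply: (@hausdorff_pre_finite_cover _ cell) => //; first by rewrite divr_ge0.
    move=> x Ex.
    have y0 j : 0 <= (x ord0 (lift i j) + m%:R) * N%:R.
      rewrite mulr_ge0//; have := Em _ (lift i j) Ex; rewrite ltr_norml => /andP[]; lra.
    have lt j : (Num.truncn ((x ord0 (lift i j) + m%:R) * N%:R) < M)%N.
      rewrite truncn_lt_nat// /M !natrM ltr_pM2r//.
      have := Em _ (lift i j) Ex; rewrite ltr_norml => /andP[]; lra.
    exists [ffun j => Ordinal (lt j)] => //; split => // j; rewrite ffunE /=.
    exact: truncn_itv.
  move=> k; rewrite /C; apply: (@diam_cone_cell i) => //.
    by move=> x y [Ex _] [Ey _]; exact: cE.
  move=> x y j [_ xk] [_ yk] ji.
  case: (unliftP i j) ji => [j' ->|->]; last by rewrite eqxx.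
  move=> _; have /andP[x1 x2] := xk j'; have /andP[y1 y2] := yk j'.
  rewrite -(@ler_pM2r _ N%:R)// mulVf ?gt_eqF// -{1}(ger0_norm (ltW N0')) -normrM.
  rewrite ler_norml; move: x1 x2 y1 y2; rewrite -!natr1; lra.
rewrite lee_fin card_ffun !card_ord natrX /M !natrM.
apply: le_trans (N1P N _); last by rewrite /N leq_max leqnn.
rewrite powRM ?invr_ge0// exprMn_comm; last exact: mulrC.
rewrite /K -!mulrA ler_wpM2l ?exprn_ge0 ?mulr_ge0// mulrCA ler_wpM2l ?powR_ge0//.
rewrite -powR_inv1// -powRrM -powR_mulrn// -powRD.
  suff -> : d.-1%:R + -1 * s = - e by [].
  by rewrite /s -subn1 natrB//; ring.
by apply/implyP => _; rewrite gt_eqF.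
Qed.

(** [hausdorff_dim_cone] speaks of bounded sets; [E] is the countable union of its bounded parts,
    each of which is null. *)
Lemma cone_set_null (q : probability (Rd R d) R) i (L : R) (E : set (Rd R d)) :
  no_mass_small_sets q -> 0 <= L -> cone_set i L E -> measurable E -> q E = 0%E.
Proof.
move=> qs L0 cE mE.
pose B (m : nat) : set (Rd R d) := E `&` [set x : V | forall j, `|x ord0 j| < m%:R].
have mB m : measurable (B m).
  apply: measurableI => //.
  have -> : [set x : V | forall j, `|x ord0 j| < m%:R] = \bigcap_(i in [set: 'I_d])
    ((fun x : Rd R d => (x : V) ord0 i) @^-1` `](- m%:R), m%:R[%classic).
    apply/seteqP; split => [x fx j _|x fx j].
      by rewrite /= in_itv/= -ltr_norml; exact: fx.
    by have := fx j I; rewrite /= in_itv/= -ltr_norml.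
  apply: fin_bigcap_measurable => [|j _]; first exact: finite_finset.
  by rewrite -[X in measurable X]setTI; exact: measurable_coord.
have -> : E = \bigcup_m B m.
  apply/seteqP; split => [x Ex|x [m _ []]//].
  exists (Num.bound (\sum_j `|(x : V) ord0 j|)) => //; split => // j.
  apply: le_lt_trans (archi_boundP _); last by apply: sumr_ge0.
  by rewrite (bigD1 j)//= lerDl sumr_ge0.
apply/eqP; rewrite -measure_le0.
apply: (le_trans (measure_sigma_subadditive _ _ _ (subset_refl _))) => //.
  exact: bigcupT_measurable.
rewrite eseries0// => m _ _; apply: qs => //; apply: (@hausdorff_dim_cone i L m) => //.
  by move=> x y [Ex _] [Ey _]; exact: cE.
by move=> x j [_]; exact.
Qed.

End LipschitzGraphs.

(** * Integrals, images and mixtures *)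

Section IntegralGeneral.
Local Open Scope ereal_scope.
Context {dT} {T : measurableType dT} {R : realType}.
Variable m : {measure set T -> \bar R}.

(* No measurability is assumed: the library integral of a nonnegative function
   is a supremum over the simple functions below it, hence always monotone. *)
Lemma integral_mono (f g : T -> \bar R) : (forall x, f x <= g x) ->
  \int[m]_x f x <= \int[m]_x g x.
Proof.
move=> fg; rewrite /integral !patch_setT.
have fg1 : {in [set: T], forall x, f x <= g x} by move=> x _.
apply: leeB; apply: ereal_sup_le => _ [h /= hf <-]; exists h => // x.
  by apply: (le_trans (hf x)); apply: (funepos_le fg1); rewrite inE.
by apply: (le_trans (hf x)); apply: (funeneg_le fg1); rewrite inE.
Qed.

Lemma measurable_fun_mem (N : set T) : measurable N ->
  measurable_fun setT (fun x => x \in N).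
Proof.
move=> mN; apply: (measurable_fun_bool true).
suff -> : [set: T] `&` (fun x => x \in N) @^-1` [set true] = N by [].
by apply/seteqP; split => [x [_ /= /set_mem]//|x Nx]; split => //; exact: mem_set.
Qed.

(** The exceptional set is absorbed by raising the measurable side [g] to [+oo] on it, while [f] is
    arbitrary. This is how the integral of [x |-> MCov (k x) q] is bounded above. *)
Lemma ae_le_integral_r (f g : T -> \bar R) : measurable_fun setT g ->
  {ae m, forall x, f x <= g x} -> \int[m]_x f x <= \int[m]_x g x.
Proof.
move=> mg [N [mN N0 subN]].
pose g' x := if x \in N then +oo else g x.
have mg' : measurable_fun setT g'.
  by apply: measurable_fun_ifT => //; exact: measurable_fun_mem.
rewrite (@ae_eq_integral _ _ _ m setT g' g)//.
  apply: integral_mono => x; rewrite /g'; case: ifPn => [_|]; first exact: leey.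
  by move=> /negP xN; apply: contrapT => nfg; apply: xN; rewrite inE; apply: subN.
exists N; split => // x /= H; apply: contrapT => xN; apply: H => _.
by rewrite /g' ifN// notin_setE.
Qed.

Lemma ae_le_integral_l (f g : T -> \bar R) : measurable_fun setT f ->
  {ae m, forall x, f x <= g x} -> \int[m]_x f x <= \int[m]_x g x.
Proof.
move=> mf [N [mN N0 subN]].
pose f' x := if x \in N then -oo else f x.
have mf' : measurable_fun setT f'.
  by apply: measurable_fun_ifT => //; exact: measurable_fun_mem.
rewrite (@ae_eq_integral _ _ _ m setT f' f)//.
  apply: integral_mono => x; rewrite /f'; case: ifPn => [_|]; first exact: leNye.
  by move=> /negP xN; apply: contrapT => nfg; apply: xN; rewrite inE; apply: subN.
exists N; split => // x /= H; apply: contrapT => xN; apply: H => _.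
by rewrite /f' ifN// notin_setE.
Qed.

(** Since [+oo - +oo] is [-oo] by convention, a finite difference of the integrals of the two parts
    forces both to be finite. *)
Lemma fin_num_integrable (f : T -> \bar R) : measurable_fun setT f ->
  \int[m]_x f x \is a fin_num -> m.-integrable setT f.
Proof.
move=> mf; rewrite integralE => H.
apply/integrableP; split => //.
have fp0 : 0 <= \int[m]_x f^\+ x by exact: integral_ge0.
have fn0 : 0 <= \int[m]_x f^\- x by exact: integral_ge0.
have [fp fn] : (\int[m]_x f^\+ x < +oo) /\ (\int[m]_x f^\- x < +oo).
  move: H fp0 fn0; case: (\int[m]_x f^\+ x) => [a||]//; case: (\int[m]_x f^\- x) => [b||]//.
  by rewrite !ltry.
under eq_integral do rewrite -/((abse \o f) _) fune_abse.
rewrite ge0_integralD//; first exact: lte_add_pinfty.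
- exact: measurable_funepos.
- exact: measurable_funeneg.
Qed.

End IntegralGeneral.

Section Image.
Local Open Scope ereal_scope.
Context {dX dY} {X : measurableType dX} {Y : measurableType dY} {R : realType}.
Variables (phi : X -> Y) (mphi : measurable_fun setT phi).
Variables (m : {measure set X -> \bar R}) (n : {measure set Y -> \bar R}).
Hypothesis mn : forall B, measurable B -> m (phi @^-1` B) = n B.

Let mphi_mixin := isMeasurableFun.Build _ _ _ _ _ mphi.
Let mphi_pack : {mfun _ >-> _} := HB.pack phi mphi_mixin.

Lemma ge0_integral_image (f : Y -> \bar R) : measurable_fun setT f ->
  (forall y, 0 <= f y) -> \int[m]_x f (phi x) = \int[n]_y f y.
Proof.
move=> mf f0.
rewrite (@eq_measure_integral _ _ _ setT (pushforward m mphi_pack)).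
  rewrite (ge0_integral_pushforward mphi m measurableT mf) ?preimage_setT// => y _; exact: f0.
by move=> B mB _; rewrite -mn.
Qed.

Lemma integrable_image (f : Y -> \bar R) : n.-integrable setT f ->
  m.-integrable setT (fun x => f (phi x)).
Proof.
move=> /integrableP[mf foo]; apply/integrableP; split; first exact: measurableT_comp.
rewrite (@ge0_integral_image (fun y => `|f y|))//.
exact: measurableT_comp.
Qed.

Lemma integral_image (f : Y -> \bar R) : measurable_fun setT f ->
  \int[m]_x f (phi x) = \int[n]_y f y.
Proof.
move=> mf; rewrite integralE [RHS]integralE.
rewrite -(ge0_integral_image (measurable_funepos mf))// -(ge0_integral_image (measurable_funeneg mf))//.
by congr (_ - _); apply: eq_integral => x _; rewrite ?funeposE ?funenegE.
Qed.

End Image.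

Section Mixture.
Local Open Scope ereal_scope.
Context {dX dY} {X : measurableType dX} {Y : measurableType dY} {R : realType}.
Variables (mu : {measure set X -> \bar R}) (n : {measure set Y -> \bar R}).
Variable l : X -> probability Y R.
Hypothesis ml : forall B, measurable B -> measurable_fun setT (fun x => l x B).
Hypothesis nl : forall B, measurable B -> n B = \int[mu]_x l x B.

Import HBNNSimple.

Lemma measurable_mixture (f : Y -> \bar R) : measurable_fun setT f ->
  (forall y, 0 <= f y) -> measurable_fun setT (fun x => \int[l x]_y f y).
Proof. by move=> mf f0; apply: measurable_fun_integral_kernel. Qed.

Lemma nnsfun_integral_mixture (f : {nnsfun Y >-> R}) :
  \int[n]_y (f y)%:E = \int[mu]_x \int[l x]_y (f y)%:E.
Proof.
rewrite integralT_nnsfun sintegralE.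
under [RHS]eq_integral do rewrite integralT_nnsfun sintegralE.
rewrite ge0_integral_fsum//; last 2 first.
- by move=> r; apply: measurable_funeM; exact: ml.
- by move=> r x _; exact: nnsfun_mulemu_ge0.
apply: eq_fsbigr => r _; have [r0|r0] := leP 0%R r.
  rewrite ge0_integralZl_EFin//; first by rewrite nl.
  exact: ml.
rewrite preimage_nnfun0// measure0 mule0.
by under eq_integral do rewrite measure0 mule0; rewrite integral0.
Qed.

Lemma ge0_integral_mixture (f : Y -> \bar R) : measurable_fun setT f ->
  (forall y, 0 <= f y) -> \int[n]_y f y = \int[mu]_x \int[l x]_y f y.
Proof.
move=> mf f0.
pose f_ := nnsfun_approx measurableT mf.
have mf_ k : measurable_fun setT (EFin \o f_ k) by exact/measurable_EFinP.
have f_0 k y : 0 <= (f_ k y)%:E by rewrite lee_fin.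
have nd y a b : (a <= b)%N -> (f_ a y)%:E <= (f_ b y)%:E.
  by move=> ab; rewrite lee_fin; exact/lefP/nd_nnsfun_approx.
have fl y : f y = limn (fun k => (f_ k y)%:E).
  by apply/esym/cvg_lim => //=; exact: cvg_nnsfun_approx.
have mc (p : {measure set Y -> \bar R}) :
    \int[p]_y f y = limn (fun k => \int[p]_y (f_ k y)%:E).
  rewrite -monotone_convergence//; first by apply: eq_integral => y _; exact: fl.
  by move=> y _ a b; exact: nd.
rewrite mc; under [RHS]eq_integral do rewrite mc.
rewrite monotone_convergence//.
- by apply: congr_lim; apply/funext => k; exact: nnsfun_integral_mixture.
- by move=> k; exact: (measurable_mixture (mf_ k) (f_0 k)).
- by move=> k x _; exact: integral_ge0.
- by move=> x _ a b ab; apply: integral_mono => y; exact: nd.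
Qed.

Lemma ae_integrable_mixture (f : Y -> \bar R) : n.-integrable setT f ->
  {ae mu, forall x, (l x).-integrable setT f}.
Proof.
move=> /integrableP[mf foo].
have ma : measurable_fun setT (fun y => `|f y|) by exact: measurableT_comp.
have : mu.-integrable setT (fun x => \int[l x]_y `|f y|).
  apply/integrableP; split; first exact: measurable_mixture.
  under eq_integral do rewrite gee0_abs ?integral_ge0//.
  by rewrite -ge0_integral_mixture.
move=> /integrable_ae => /(_ measurableT); apply: filterS => x /(_ I) fin.
by apply/integrableP; split => //; rewrite ltey_eq fin.
Qed.

Lemma integrable_integral_mixture (f : Y -> \bar R) : n.-integrable setT f ->
  mu.-integrable setT (fun x => \int[l x]_y f y) /\
  \int[mu]_x \int[l x]_y f y = \int[n]_y f y.
Proof.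
move=> /integrableP[mf foo].
have mp := measurable_funepos mf; have mn := measurable_funeneg mf.
have ma : measurable_fun setT (fun y => `|f y|) by exact: measurableT_comp.
have ip : mu.-integrable setT (fun x => \int[l x]_y f^\+ y).
  apply/integrableP; split; first exact: measurable_mixture.
  under eq_integral do rewrite gee0_abs ?integral_ge0//.
  rewrite -ge0_integral_mixture//; apply: le_lt_trans foo; apply: integral_mono => y.
  by rewrite -/((abse \o f) y) fune_abse leeDl.
have in_ : mu.-integrable setT (fun x => \int[l x]_y f^\- y).
  apply/integrableP; split; first exact: measurable_mixture.
  under eq_integral do rewrite gee0_abs ?integral_ge0//.
  rewrite -ge0_integral_mixture//; apply: le_lt_trans foo; apply: integral_mono => y.
  by rewrite -/((abse \o f) y) fune_abse leeDr.
(* By definition the inner integral is the difference of those of the two parts for every [x], even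
   where [f] is not integrable under [l x]. *)
under [X in _.-integrable _ X]eq_fun do rewrite integralE.
split; first exact: integrableB.
under eq_integral do rewrite integralE.
by rewrite integralB// [RHS]integralE !ge0_integral_mixture.
Qed.

End Mixture.

(** * Finitely additive plans *)

Section Plans.
Context {dW} {W : measurableType dW} {R : realType} {d : nat}.
Notation V := 'rV[R]_d.
Variables (P : probability W R) (nu : probability (Rd R d) R).
Implicit Types (h f g : W * V -> R) (N M : set (W * V)) (L : (W * V -> R) -> R).

Definition rintegrable {dT} {T : measurableType dT} (m : {measure set T -> \bar R})
  (f : T -> R) := m.-integrable setT (EFin \o f).

(** Only domination is asked of [h], not measurability: a plan is evaluated on indicators of
    arbitrary sets. *)
Definition plan_dom h := exists (phi : W -> R) (chi : Rd R d -> R),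
  [/\ rintegrable P phi, rintegrable nu chi & forall s, `|h s| <= phi s.1 + chi s.2].

(* A plan is a positive linear functional standing for the expectation under a
   coupling of P and nu; it is only finitely additive a priori. *)
Definition plan L := [/\
  (forall k f g, plan_dom f -> plan_dom g ->
     L (fun s => k * f s + g s) = k * L f + L g),
  (forall f, plan_dom f -> (forall s, 0 <= f s) -> 0 <= L f),
  (forall phi, rintegrable P phi -> L (fun s => phi s.1) = \int[P]_w phi w)
& (forall chi : Rd R d -> R, rintegrable nu chi -> L (fun s => chi s.2) = \int[nu]_y chi y)].

Lemma rintegrableD {dT} {T : measurableType dT} (m : {measure set T -> \bar R}) (f g : T -> R) :
  rintegrable m f -> rintegrable m g -> rintegrable m (fun x => f x + g x).
Proof. by move=> mf mg; apply: eq_integrable (integrableD measurableT mf mg). Qed.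

Lemma rintegrableZ {dT} {T : measurableType dT} (m : {measure set T -> \bar R}) k (f : T -> R) :
  rintegrable m f -> rintegrable m (fun x => k * f x).
Proof. by move=> mf; apply: eq_integrable (integrableZl measurableT k mf). Qed.

Lemma rintegrable_norm {dT} {T : measurableType dT} (m : {measure set T -> \bar R}) (f : T -> R) :
  rintegrable m f -> rintegrable m (fun x => `|f x|).
Proof. by move=> mf; apply: eq_integrable (integrable_norm mf). Qed.

Lemma rintegrable_cst {dT} {T : measurableType dT} (m : probability T R) (k : R) :
  rintegrable m (fun=> k).
Proof.
exact: finite_measure_integrable_cst.
Qed.

Lemma rintegrable_le {dT} {T : measurableType dT} (m : {measure set T -> \bar R}) (f g : T -> R) :
  measurable_fun setT f -> rintegrable m g -> (forall x, `|f x| <= g x) -> rintegrable m f.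
Proof.
move=> mf mg fg; apply: le_integrable mg => //; first exact/measurable_EFinP.
by move=> x _; rewrite lee_fin (le_trans (fg x))// ler_norm.
Qed.

Lemma rintegrable_bounded {dT} {T : measurableType dT} (m : probability T R) (f : T -> R) k :
  measurable_fun setT f -> (forall x, `|f x| <= k) -> rintegrable m f.
Proof. by move=> mf fk; apply: rintegrable_le (rintegrable_cst m k) fk. Qed.

Lemma rintegrable_measurable {dT} {T : measurableType dT} (m : {measure set T -> \bar R}) (f : T -> R) :
  rintegrable m f -> measurable_fun setT f.
Proof. by move=> /measurable_int/measurable_EFinP. Qed.

Lemma rintegrable_indic {dT} {T : measurableType dT} (m : probability T R) (A : set T) :
  measurable A -> rintegrable m (\1_A).
Proof.
move=> mA; apply: (@rintegrable_bounded _ _ _ _ 1); first exact: measurable_indic.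
by move=> x; rewrite indicE; case: (_ \in _); rewrite ?normr1// normr0.
Qed.

Lemma Rintegral_indic {dT} {T : measurableType dT} (m : probability T R) (A : set T) :
  measurable A -> \int[m]_x \1_A x = fine (m A).
Proof. by move=> mA; rewrite /Rintegral integral_indic// setIT. Qed.

Lemma plan_dom_le f g : plan_dom g -> (forall s, `|f s| <= `|g s|) -> plan_dom f.
Proof.
move=> [phi [chi [ip ic gs]]] fg; exists phi, chi; split => // s.
exact: le_trans (fg s) (gs s).
Qed.

Lemma plan_dom_fst phi : rintegrable P phi -> plan_dom (fun s => phi s.1).
Proof.
move=> ip; exists (fun w => `|phi w|), (fun=> 0); split.
- exact: rintegrable_norm.
- exact: rintegrable_cst.
- by move=> s; rewrite addr0.
Qed.

Lemma plan_dom_snd (chi : Rd R d -> R) : rintegrable nu chi -> plan_dom (fun s => chi s.2).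
Proof.
move=> ip; exists (fun=> 0), (fun w => `|chi w|); split.
- exact: rintegrable_cst.
- exact: rintegrable_norm.
- by move=> s; rewrite add0r.
Qed.

Lemma plan_domD f g : plan_dom f -> plan_dom g -> plan_dom (fun s => f s + g s).
Proof.
move=> [p1 [c1 [ip1 ic1 h1]]] [p2 [c2 [ip2 ic2 h2]]].
exists (fun w => p1 w + p2 w), (fun y => c1 y + c2 y); split; try exact: rintegrableD.
by move=> s; apply: (le_trans (ler_normD _ _)); have := h1 s; have := h2 s; lra.
Qed.

Lemma plan_domZ k f : plan_dom f -> plan_dom (fun s => k * f s).
Proof.
move=> [p1 [c1 [ip1 ic1 h1]]].
exists (fun w => `|k| * p1 w), (fun y => `|k| * c1 y); split; try exact: rintegrableZ.
by move=> s; rewrite normrM -mulrDr ler_wpM2l.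
Qed.

Lemma plan_domB f g : plan_dom f -> plan_dom g -> plan_dom (fun s => f s - g s).
Proof.
move=> df dg; have := plan_domD df (plan_domZ (-1) dg).
by congr plan_dom; apply/funext => s; rewrite mulN1r.
Qed.

Lemma plan_dom_norm f : plan_dom f -> plan_dom (fun s => `|f s|).
Proof. by move=> df; apply: plan_dom_le df _ => s; rewrite normr_id. Qed.

Lemma plan_dom_bounded f k : (forall s, `|f s| <= k) -> plan_dom f.
Proof.
move=> fk; exists (fun=> k), (fun=> 0); split; try exact: rintegrable_cst.
by move=> s; rewrite addr0.
Qed.

Lemma plan_dom_indic N : plan_dom (\1_N).
Proof.
apply: (@plan_dom_bounded _ 1) => s.
by rewrite indicE; case: (_ \in _); rewrite ?normr1// normr0.
Qed.

Lemma plan_dom_indicM f N : plan_dom f -> plan_dom (fun s => f s * \1_N s).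
Proof.
move=> df; apply: plan_dom_le df _ => s; rewrite indicE.
by case: (_ \in _); rewrite ?mulr1// mulr0 normr0.
Qed.

Section PlanTheory.
Variables (L : (W * V -> R) -> R) (pL : plan L).

Lemma planD f g : plan_dom f -> plan_dom g -> L (fun s => f s + g s) = L f + L g.
Proof.
case: pL => lin _ _ _ df dg; have := lin 1 _ _ df dg; rewrite mul1r => <-.
by congr L; apply/funext => s; rewrite mul1r.
Qed.

Lemma planZ k f : plan_dom f -> L (fun s => k * f s) = k * L f.
Proof.
case: pL => lin _ _ _ df; have d0 : plan_dom (fun=> 0).
  by apply: (@plan_dom_bounded _ 0) => s; rewrite normr0.
have L0 : L (fun=> 0) = 0.
  have := lin (-1) _ _ d0 d0; rewrite [X in L X](_ : _ = fun=> 0); first by lra.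
  by apply/funext => s; rewrite mulr0 addr0.
have := lin k _ _ df d0; rewrite L0 addr0 => <-; congr L.
by apply/funext => s; rewrite addr0.
Qed.

Lemma planB f g : plan_dom f -> plan_dom g -> L (fun s => f s - g s) = L f - L g.
Proof.
move=> df dg; have := planD df (plan_domZ (-1) dg); rewrite planZ//.
rewrite [in L f - _](_ : - L g = -1 * L g) ?mulN1r// => <-.
by congr L; apply/funext => s; rewrite mulN1r.
Qed.

Lemma plan_ge0 f : plan_dom f -> (forall s, 0 <= f s) -> 0 <= L f.
Proof. by case: pL => _ H _ _; exact: H. Qed.

Lemma plan_le f g : plan_dom f -> plan_dom g -> (forall s, f s <= g s) -> L f <= L g.
Proof.
move=> df dg fg; rewrite -subr_ge0 -planB//; apply: plan_ge0; first exact: plan_domB.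
by move=> s; rewrite subr_ge0.
Qed.

Lemma plan_norm f : plan_dom f -> `|L f| <= L (fun s => `|f s|).
Proof.
move=> df; rewrite ler_norml; apply/andP; split.
  rewrite -mulN1r -planZ; last exact: plan_dom_norm.
  apply: plan_le => //; first by apply: plan_domZ; exact: plan_dom_norm.
  by move=> s; rewrite mulN1r lerNl -normrN ler_norm.
by apply: plan_le => //; [exact: plan_dom_norm|move=> s; exact: ler_norm].
Qed.

Lemma plan_fst phi : rintegrable P phi -> L (fun s => phi s.1) = \int[P]_w phi w.
Proof. by case: pL => _ _ H _; exact: H. Qed.

Lemma plan_snd (chi : Rd R d -> R) : rintegrable nu chi -> L (fun s => chi s.2) = \int[nu]_y chi y.
Proof. by case: pL => _ _ _ H; exact: H. Qed.

Lemma plan_indic_fst (A : set W) : measurable A -> L (\1_(fst @^-1` A)) = fine (P A).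
Proof.
move=> mA; rewrite -Rintegral_indic// -plan_fst; last exact: rintegrable_indic.
by congr L; apply/funext => s; rewrite !indicE; congr (_ : bool)%:R; apply/idP/idP; rewrite !inE.
Qed.

Lemma plan_indic_snd (A : set (Rd R d)) : measurable A -> L (\1_(snd @^-1` A)) = fine (nu A).
Proof.
move=> mA; rewrite -Rintegral_indic// -plan_snd; last exact: rintegrable_indic.
by congr L; apply/funext => s; rewrite !indicE; congr (_ : bool)%:R; apply/idP/idP; rewrite !inE.
Qed.

Lemma indic_le N M : N `<=` M -> forall s, (\1_N s : R) <= \1_M s.
Proof.
move=> NM s; rewrite !indicE ler_nat; case: (boolP (s \in N)) => // /set_mem /NM sM.
by rewrite mem_set.
Qed.

Lemma plan_indic_le N M : N `<=` M -> L (\1_N) <= L (\1_M).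
Proof. by move=> NM; apply: plan_le; [exact: plan_dom_indic..|exact: indic_le]. Qed.

Lemma indic_setU_le N M s : (\1_(N `|` M) s : R) <= \1_N s + \1_M s.
Proof. by rewrite !indicE in_setU; case: (s \in N); case: (s \in M); rewrite /= ?addr0 ?add0r ?ler01// lerDl. Qed.

Lemma plan_indicU N M : L (\1_(N `|` M)) <= L (\1_N) + L (\1_M).
Proof.
rewrite -planD; [|exact: plan_dom_indic..].
apply: plan_le; first exact: plan_dom_indic.
  by apply: plan_domD; exact: plan_dom_indic.
by move=> s; exact: indic_setU_le.
Qed.

Lemma plan_indic_ge0 N : 0 <= L (\1_N).
Proof. by apply: plan_ge0; [exact: plan_dom_indic|move=> s]. Qed.

(** Such sets are stable under finite unions only. A countable union is treated by discarding an
    event of small [P]-mass or [nu]-mass first. *)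
Definition plan_null N := L (\1_N) = 0.

Lemma plan_null_le N : (forall e, 0 < e -> L (\1_N) <= e) -> plan_null N.
Proof.
move=> H; apply/eqP; rewrite eq_le plan_indic_ge0 andbT; apply/ler_addgt0Pr => e e0.
by rewrite add0r; exact: H.
Qed.

Lemma plan_nullS N M : N `<=` M -> plan_null M -> plan_null N.
Proof.
move=> NM M0; apply/eqP; rewrite eq_le plan_indic_ge0 andbT.
by rewrite -M0; exact: plan_indic_le.
Qed.

Lemma plan_nullU N M : plan_null N -> plan_null M -> plan_null (N `|` M).
Proof.
move=> N0 M0; apply: plan_null_le => e e0; apply: (le_trans (plan_indicU N M)).
by rewrite N0 M0 addr0 ltW.
Qed.

Lemma plan_null_bigU (I : Type) (r : seq I) (F : I -> set (W * V)) :
  (forall i, plan_null (F i)) -> plan_null (\big[setU/set0]_(i <- r) F i).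
Proof.
move=> F0; elim/big_rec : _ => [|i N _ N0]; last exact: plan_nullU.
rewrite /plan_null (_ : \1_set0 = fun s => 0 * \1_set0 s).
  by rewrite planZ ?mul0r//; exact: plan_dom_indic.
by apply/funext => s; rewrite indic0 mul0r.
Qed.

Lemma plan_null_fst (A : set W) : measurable A -> P A = 0%E -> plan_null (fst @^-1` A).
Proof. by move=> mA A0; rewrite /plan_null plan_indic_fst// A0. Qed.

End PlanTheory.
End Plans.

Section Tails.
Context {dT} {T : measurableType dT} {R : realType}.

(** Dominated convergence holds for the marginals but not for a plan, so truncation errors are
    estimated on the marginals. *)
Lemma rintegrable_tail (m : probability T R) (f : T -> R) (e : R) : rintegrable m f -> 0 < e ->
  exists K : nat, rintegrable m (fun x => f x * \1_[set x | K%:R < f x] x) /\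
    \int[m]_x (f x * \1_[set x | K%:R < f x] x) <= e.
Proof.
move=> If e0.
have mf := rintegrable_measurable If.
have mS K : measurable [set x | K%:R < f x].
  rewrite -[X in measurable X]setTI.
  have -> : [set x | K%:R < f x] = f @^-1` `]K%:R, +oo[%classic.
    by apply/seteqP; split => x /=; rewrite in_itv/= andbT.
  exact: mf.
pose g (K : nat) x := f x * \1_[set x | K%:R < f x] x.
have mg K : measurable_fun setT (g K) by apply: measurable_funM => //; exact: measurable_indic.
have gf K x : `|g K x| <= `|f x|.
  by rewrite /g indicE; case: (_ \in _); rewrite ?mulr1// mulr0 normr0.
have cv x : EFin \o g ^~ x @ \oo --> 0%:E.
  apply: cvg_near_cst; exists (Num.bound (`|f x|)) => // n /= bn.
  rewrite /g indicE memNset ?mulr0//= => nf.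
  have := le_lt_trans (ler_norm (f x)) (archi_boundP (normr_ge0 (f x))).
  by move=> /(lt_trans nf); rewrite ltr_nat ltnNge bn.
have Ig K : rintegrable m (g K) by exact: rintegrable_le (mg K) (rintegrable_norm If) (gf K).
pose h K := EFin \o g K.
have ae1 : {ae m, forall x, [set: T] x -> h ^~ x @ \oo --> cst 0%E x}.
  by apply: aeW => x _; exact: cv.
have ae2 : {ae m, forall x K, [set: T] x -> (`|h K x|%E <= (EFin \o (fun x => `|f x|%R)) x)%E}.
  by apply: aeW => x K _; rewrite /= lee_fin.
have [_ _] := dominated_convergence measurableT (fun K => (measurable_EFinP _ _).2 (mg K))
   (measurable_cst _) ae1 (rintegrable_norm If) ae2.
rewrite integral0 => /fine_cvg /= /cvgr_le /(_ _ e0)[n _ /(_ _ (leqnn n)) /= H].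
by exists n; split; [exact: Ig|exact: H].
Qed.

Lemma continuity_above (m : {measure set T -> \bar R}) (F : (set T)^nat) (e : R) :
  (m setT < +oo)%E -> (forall n, measurable (F n)) -> nonincreasing_seq F -> 0 < e ->
  exists n, (m (F n) <= m (\bigcap_n F n) + e%:E)%E.
Proof.
move=> moo mF niF e0.
have mI : measurable (\bigcap_n F n) by exact: bigcapT_measurable.
have fin A : measurable A -> m A \is a fin_num.
  move=> mA; rewrite ge0_fin_numE//; apply: le_lt_trans moo.
  by apply: le_measure; rewrite ?inE.
have := nonincreasing_cvg_mu (mu := m) _ mF mI niF.
rewrite ltey_eq fin// => /(_ isT).
rewrite -[X in _ --> X](@fineK _ (m _)) ?fin// => /fine_cvg /= /cvgr_le.
move=> /(_ (fine (m (\bigcap_n F n)) + e)); rewrite ltrDl => /(_ e0)[n _ /(_ _ (leqnn n)) /= H].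
exists n; rewrite -(fineK (fin _ (mF n))) -[X in (_ <= X + _)%E](@fineK _ (m _)) ?fin//.
Qed.

End Tails.

(** * Plans carried by the graph of a Borel map *)

Section Graphs.
Context {dW} {W : measurableType dW} {R : realType} {d : nat}.
Notation V := 'rV[R]_d.
Variables (P : probability W R) (nu : probability (Rd R d) R).
Variables (L : (W * V -> R) -> R) (pL : plan P nu L).

(** On [N], [|f|] is at most [K1 + K2] plus the parts of [phi] and [chi] above these heights. The
    constant contributes nothing, and the tails are small by their marginal integrals. *)
Lemma plan_null_dom (f : W * V -> R) N : plan_dom P nu f -> plan_null L N ->
  L (fun s => `|f s| * \1_N s) = 0.
Proof.
move=> df N0.
have dfN : plan_dom P nu (fun s => `|f s| * \1_N s).
  by apply: plan_dom_indicM; exact: plan_dom_norm.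
apply/eqP; rewrite eq_le; apply/andP; split; last first.
  by apply: (plan_ge0 pL) => // s; rewrite mulr_ge0.
apply/ler_addgt0Pr => e e0; rewrite add0r.
have [phi [chi [Ip Ic fpc]]] := df.
have e2 : 0 < e / 2 by rewrite divr_gt0.
have [K1 [I1 le1]] := rintegrable_tail Ip e2.
have [K2 [I2 le2]] := rintegrable_tail Ic e2.
set g1 := (fun w => phi w * _) in I1 le1; set g2 := (fun y => chi y * _) in I2 le2.
have d1 := plan_dom_fst nu I1; have d2 := plan_dom_snd P I2.
have d12 := plan_domD d1 d2.
have dN := plan_domZ (K1%:R + K2%:R) (plan_dom_indic P nu N).
have -> : e = L (fun s => (K1%:R + K2%:R) * \1_N s + (g1 s.1 + g2 s.2)) +
   (e - (L (fun s => g1 s.1) + L (fun s => g2 s.2))).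
  rewrite (planD pL dN d12) (planD pL d1 d2) (planZ pL); last exact: plan_dom_indic.
  by rewrite N0; ring.
rewrite -[leLHS]addr0 lerD//; last first.
  by rewrite (plan_fst pL)// (plan_snd pL)// subr_ge0; lra.
apply: (plan_le pL) => //; first exact: plan_domD.
have i1 w : \1_[set x | K1%:R < phi x] w = (K1%:R < phi w)%R%:R :> R.
  by rewrite indicE; congr (nat_of_bool _)%:R; apply/idP/idP; rewrite inE.
have i2 y : \1_[set x | K2%:R < chi x] y = (K2%:R < chi y)%R%:R :> R.
  by rewrite indicE; congr (nat_of_bool _)%:R; apply/idP/idP; rewrite inE.
move=> s; have fs := fpc s; rewrite /g1 /g2 i1 i2 indicE.
have f0 := normr_ge0 (f s).
have n1 : (0:R) <= K1%:R by []. have n2 : (0:R) <= K2%:R by [].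
case: (s \in N); rewrite /= ?mulr1 ?mulr0;
case: (ltP K1%:R (phi s.1)) => k1; case: (ltP K2%:R (chi s.2)) => k2;
rewrite /= ?mulr1 ?mulr0 ?addr0 ?add0r; lra.
Qed.

Definition off_graph (T : W -> Rd R d) (e : R) : set (W * V) :=
  [set s : W * V | exists i, e < `|s.2 ord0 i - (T s.1 : V) ord0 i|].

(** The event is null for each [e]; the union over [e], where [y] differs from [T w], need not be
    null for a finitely additive [L]. *)
Definition on_graph (T : W -> Rd R d) := forall e, 0 < e -> plan_null L (off_graph T e).

Variables (T : W -> Rd R d) (mT : measurable_fun setT T) (gT : on_graph T).

Lemma on_graph_orthant_le (A : set W) a (e : R) : measurable A -> 0 < e ->
  L (\1_[set s : W * V | A s.1 /\ orthant a s.2]) <=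
    fine (P (A `&` T @^-1` orthant (a + const_mx e))) /\
  fine (P (A `&` T @^-1` orthant a)) <= L (\1_[set s : W * V | A s.1 /\ orthant (a + const_mx e) s.2]).
Proof.
move=> mA e0.
have mTo b : measurable (A `&` T @^-1` orthant b).
  apply: measurableI => //; rewrite -[X in measurable X]setTI; apply: mT => //.
  exact: measurable_orthant.
have N0 := gT e0.
have nN s : ~ off_graph T e s -> forall i, `|s.2 ord0 i - (T s.1 : V) ord0 i| <= e.
  by move=> H i; rewrite leNgt; apply/negP => ?; apply: H; exists i.
split; rewrite -(plan_indic_fst pL)//.
  rewrite -[leRHS]add0r -N0; apply: le_trans (plan_indicU pL _ _).
  apply: (plan_indic_le pL) => s [As Cs].
  have [|ns] := pselect (off_graph T e s); [by left|right; split => // i].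
  have := nN _ ns i; have := Cs i; rewrite !mxE ler_norml => ? /andP[]; lra.
rewrite -[leRHS]add0r -N0; apply: le_trans (plan_indicU pL _ _).
apply: (plan_indic_le pL) => s [As Cs].
have [|ns] := pselect (off_graph T e s); [by left|right; split => // i].
have := nN _ ns i; have := Cs i; rewrite !mxE ler_norml => ? /andP[]; lra.
Qed.

Lemma orthant_right_continuous (k : {measure set (Rd R d) -> \bar R}) a (x : R) :
  (k setT < +oo)%E -> (forall e, 0 < e -> x <= fine (k (orthant (a + const_mx e)))) ->
  x <= fine (k (orthant a)).
Proof.
move=> koo H; apply/ler_addgt0Pr => e e0.
pose F n := orthant (a + const_mx (n.+1%:R^-1)).
have [||n] := continuity_above koo (F := F) _ _ e0.
- by move=> n; exact: measurable_orthant.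
- move=> m n mn; apply/subsetPset => y yF i; apply: (le_trans (yF i)).
  by rewrite !mxE lerD2l lef_pV2 ?posrE// ler_nat.
have -> : \bigcap_n F n = orthant a.
  apply/seteqP; split => [y yF i|y ya m _ i]; last first.
    by rewrite !mxE (le_trans (ya i))// lerDl.
  apply/ler_addgt0Pr => eps eps0.
  have := yF (Num.bound eps^-1) I i; rewrite !mxE => /le_trans; apply.
  rewrite lerD2l invf_ple ?posrE//; apply: ltW; apply: (lt_le_trans (archi_boundP _)).
    by rewrite invr_ge0 ltW.
  by rewrite ler_nat.
have fin B : measurable B -> k B \is a fin_num.
  move=> mB; rewrite ge0_fin_numE//; apply: le_lt_trans koo.
  by apply: le_measure; rewrite ?inE.
have mo := @measurable_orthant R d.
move=> Hn; apply: (le_trans (H n.+1%:R^-1 _)); first by rewrite invr_gt0.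
by rewrite -lee_fin EFinD !fineK ?fin.
Qed.

(** Countable additivity is recovered here. [k] and the image under [T] of [P] restricted to [A] are
    genuine measures; on orthants each is at most the other after a shift of the corner by any
    [e > 0], and right continuity of both removes the shift. *)
Lemma on_graph_law (A : set W) (k : {measure set (Rd R d) -> \bar R}) : measurable A ->
  (k setT < +oo)%E ->
  (forall B : set (Rd R d), measurable B -> L (\1_[set s : W * V | A s.1 /\ B s.2]) = fine (k B)) ->
  forall B, measurable B -> P (A `&` T @^-1` B) = k B.
Proof.
move=> mA koo Lk B mB.
pose k2f : {measure set (Rd R d) -> \bar R} :=
  pushforward (mrestr P mA) T.
pose k2 := k2f mT.
have k2E C : k2 C = P (A `&` T @^-1` C) by rewrite /= /pushforward /mrestr setIC.
rewrite -k2E; apply: orthant_measure_unique => //.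
  by rewrite k2E preimage_setT setIT ltey_eq fin_num_measure.
move=> a; have mo := @measurable_orthant R d.
have fk C : measurable C -> k C \is a fin_num.
  move=> mC; rewrite ge0_fin_numE//; apply: le_lt_trans koo.
  by apply: le_measure; rewrite ?inE.
have k2oo : (k2 setT < +oo)%E by rewrite k2E preimage_setT setIT ltey_eq fin_num_measure.
have fk2 C : measurable C -> k2 C \is a fin_num.
  move=> mC; rewrite ge0_fin_numE//; apply: le_lt_trans k2oo.
  by apply: le_measure; rewrite ?inE.
rewrite -(fineK (fk _ (mo a))) -(fineK (fk2 _ (mo a))); congr EFin.
apply/eqP; rewrite eq_le; apply/andP; split.
  apply: orthant_right_continuous => // e e0; rewrite -Lk//.
  by rewrite k2E; exact: (on_graph_orthant_le a mA e0).2.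
apply: orthant_right_continuous => // e e0; rewrite -Lk//.
by rewrite k2E; exact: (on_graph_orthant_le a mA e0).1.
Qed.

Lemma on_graph_snd_law B : measurable B -> P (T @^-1` B) = nu B.
Proof.
move=> mB; rewrite -[X in P X]setTI; apply: on_graph_law => //.
  by rewrite [X in (X < _)%E](@probability_setT _ _ _ nu) ltry.
move=> C mC; rewrite -(plan_indic_snd pL)//; congr L; congr (\1_ _).
by apply/seteqP; split => [s []|s].
Qed.

(** Square integrability of [g] and [y_i] puts the product in the domain of [L]. Replacing [y_i] by
    [T_i] costs at most [e / (C + 1) * |g|] off an [off_graph] event, with [C] the integral of
    [|g|], and nothing on that event by [plan_null_dom]. *)
Lemma on_graph_mul (i : 'I_d) (g : W -> R) : measurable_fun setT g ->
  rintegrable P (fun w => g w ^+ 2) ->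
  rintegrable nu (fun y : Rd R d => (y : V) ord0 i ^+ 2) ->
  rintegrable P (fun w => (T w : V) ord0 i * g w) /\
  L (fun s => s.2 ord0 i * g s.1) = \int[P]_w ((T w : V) ord0 i * g w).
Proof.
move=> mg Ig Iy.
have mTi : measurable_fun setT (fun w => (T w : V) ord0 i) by exact: measurable_coord_comp.
have IT : rintegrable P (fun w => (T w : V) ord0 i ^+ 2).
  exact: (integrable_image mT (fun B mB => on_graph_snd_law mB) Iy).
have ab (x y : R) : `|x * y| <= x ^+ 2 + y ^+ 2.
  rewrite ler_norml; have := sqr_ge0 (x - y); have := sqr_ge0 (x + y).
  by move=> h1 h2; apply/andP; split; nra.
have ITg : rintegrable P (fun w => (T w : V) ord0 i * g w).
  apply: (@rintegrable_le _ _ _ _ _ (fun w => (T w : V) ord0 i ^+ 2 + g w ^+ 2)) => //.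
  - exact: measurable_funM.
  - exact: rintegrableD.
have Iag : rintegrable P (fun w => `|g w|).
  apply: (@rintegrable_le _ _ _ _ _ (fun w => 1 + g w ^+ 2)).
  - exact: measurableT_comp.
  - by apply: rintegrableD => //; exact: rintegrable_cst.
  - by move=> w; rewrite normr_id; have := ab 1 (g w); rewrite mul1r expr1n.
have d1 : plan_dom P nu (fun s => s.2 ord0 i * g s.1).
  by exists (fun w => g w ^+ 2), (fun y => (y : V) ord0 i ^+ 2); split => // s; rewrite addrC; exact: ab.
have d2 := plan_dom_fst nu ITg.
split => //; rewrite -(plan_fst pL ITg).
apply/eqP; rewrite -subr_eq0 -(planB pL)// -normr_le0.
have d3 := plan_domB d1 d2.
apply: (le_trans (plan_norm pL d3)).
apply/ler_addgt0Pr => e e0; rewrite add0r.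
pose C := \int[P]_w `|g w|.
have C0 : 0 <= C by exact: Rintegral_ge0.
have ep0 : 0 < e / (C + 1) by rewrite divr_gt0// ltr_wpDl.
set N := off_graph T (e / (C + 1)).
have N0 : plan_null L N by exact: gT.
have d4 : plan_dom P nu (fun s => (e / (C + 1)) * `|g s.1|).
  exact: (plan_domZ (e / (C + 1)) (plan_dom_fst nu Iag)).
have d5 : plan_dom P nu (fun s => `|s.2 ord0 i * g s.1 - (T s.1 : V) ord0 i * g s.1| * \1_N s).
  by apply: plan_dom_indicM; exact: plan_dom_norm.
apply: (@le_trans _ _ (L (fun s => (e / (C + 1)) * `|g s.1| +
    `|s.2 ord0 i * g s.1 - (T s.1 : V) ord0 i * g s.1| * \1_N s))).
  apply: (plan_le pL); [exact: plan_dom_norm|exact: plan_domD|move=> s].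
  rewrite indicE; case: (boolP (s \in N)) => [_|/negP nN].
    by rewrite mulr1 lerDr mulr_ge0// ltW.
  rewrite mulr0 addr0 -mulrBl normrM ler_wpM2r// leNgt; apply/negP => H; apply: nN.
  by rewrite inE; exists i.
rewrite (planD pL)// (plan_null_dom d3 N0) addr0 (planZ pL); last exact: (plan_dom_fst nu Iag).
rewrite (plan_fst pL Iag) -/C -mulrA ler_piMr ?(ltW e0)// mulrC ler_pdivrMr ?ltr_wpDl//.
by rewrite mul1r lerDl.
Qed.

End Graphs.

(** * A Borel map reconstructed from level events *)

Section GraphFromLevels.
Context {dW} {W : measurableType dW} {R : realType} {d : nat}.
Notation V := 'rV[R]_d.
Variables (P : probability W R) (nu : probability (Rd R d) R).
Variables (L : (W * V -> R) -> R) (pL : plan P nu L).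

Lemma plan_null_P (A : set W) : measurable A -> plan_null L (fst @^-1` A) -> P A = 0%E.
Proof.
move=> mA; rewrite /plan_null (plan_indic_fst pL)// => A0.
by rewrite -(@fineK _ (P A)) ?fin_num_measure// A0.
Qed.

Lemma null_bigcup (F : (set W)^nat) : (forall n, measurable (F n)) ->
  (forall n, P (F n) = 0%E) -> P (\bigcup_n F n) = 0%E.
Proof.
move=> mF F0; apply/eqP; rewrite -measure_le0.
apply: (le_trans (measure_sigma_subadditive _ _ _ (subset_refl _))) => //.
  exact: bigcupT_measurable.
by rewrite eseries0// => n _ _; exact: F0.
Qed.

(** Tightness of [nu], which later replaces countably many levels by finitely many up to an error
    [e]. *)
Lemma snd_tail (e : R) : 0 < e -> exists N : nat,
  L (\1_[set s : W * V | exists i, N%:R < `|s.2 ord0 i|]) <= e.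
Proof.
move=> e0.
pose F (N : nat) : set (Rd R d) := [set y | exists i, N%:R < `|(y : V) ord0 i|].
have mF N : measurable (F N).
  have -> : F N = \bigcup_(i in [set: 'I_d])
      ((fun y : Rd R d => `|(y : V) ord0 i|) @^-1` `]N%:R, +oo[%classic).
    apply/seteqP; split => [x [i Hi]|x [i _]]; first by exists i => //=; rewrite in_itv/= andbT.
    by rewrite /= in_itv/= andbT => ?; exists i.
  apply: fin_bigcup_measurable => [|i _]; first exact: finite_finset.
  rewrite -[X in measurable X]setTI; apply: measurableT_comp => //.
  exact: measurable_coord.
have [||n] := continuity_above (m := nu) _ mF _ e0.
- by rewrite [X in (X < _)%E](@probability_setT _ _ _ nu) ltry.
- by move=> m n mn; apply/subsetPset => y [i Hi]; exists i; apply: le_lt_trans Hi; rewrite ler_nat.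
have -> : \bigcap_n F n = set0.
  apply/seteqP; split => // y yF.
  have [i] := yF (Num.bound (\sum_j `|(y : V) ord0 j|)) I.
  apply/negP; rewrite -leNgt (le_trans _ (ltW (archi_boundP _)))//; last exact: sumr_ge0.
  by rewrite (bigD1 i)//= lerDl sumr_ge0.
rewrite measure0 add0e => H; exists n.
have := plan_indic_snd pL (mF n).
rewrite (_ : snd @^-1` F n = [set s : W * V | exists i, n%:R < `|s.2 ord0 i|])//.
by move=> ->; rewrite -lee_fin fineK ?fin_num_measure.
Qed.

(** [Em i a] and [Ep i a] stand for the events of [w] from which [y_i <= a], respectively
    [y_i >= a], remains possible. *)
Variables (Em Ep : 'I_d -> rat -> set W).
Hypothesis mEm : forall i a, measurable (Em i a).
Hypothesis mEp : forall i a, measurable (Ep i a).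
Hypothesis Em0 : forall i a,
  plan_null L [set s : W * V | ~ Em i a s.1 /\ s.2 ord0 i <= ratr a].
Hypothesis Ep0 : forall i a,
  plan_null L [set s : W * V | ~ Ep i a s.1 /\ ratr a <= s.2 ord0 i].
Hypothesis Emp0 : forall i a b, a < b -> P (Em i a `&` Ep i b) = 0%E.

Definition level_inf i (w : W) : \bar R :=
  ereal_inf [set (ratr a)%:E | a in [set a | Em i a w]].

Lemma measurable_level_inf i : measurable_fun setT (level_inf i).
Proof.
apply: (measurability _ (ErealGenInftyO.measurableE R)) => _ [_ [r ->] <-].
rewrite setTI.
have -> : level_inf i @^-1` `]-oo, r%:E[%classic =
    \bigcup_a (if ratr a < r then Em i a else set0).
  apply/seteqP; split => [w|w [a _]].
    by rewrite /= in_itv/= => /ereal_inf_lt[_ [a Ea <-]]; rewrite lte_fin => ar; exists a; rewrite ?ar.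
  case: ifPn => // ar Ea; rewrite /= in_itv/=; apply: le_lt_trans (_ : (ratr a)%:E < _)%E.
    by apply: ereal_inf_lbound; exists a.
  by rewrite lte_fin.
apply: countable_bigcupT_measurable => // a; case: ifPn => // _; exact: mEm.
Qed.

(** [fine] sends infinite levels to [0]. Off [level_bad], a level is finite as soon as some [Ep i a]
    and some [Em i b] contain [w]. *)
Definition level_map (w : W) : Rd R d := \row_i fine (level_inf i w).

Lemma measurable_level_map : measurable_fun setT level_map.
Proof.
apply: measurable_fun_Rd => i.
under eq_fun do rewrite mxE.
apply: measurableT_comp; first exact: fine_measurable.
exact: measurable_level_inf.
Qed.

Definition level_bad i : set W := \bigcup_n (if (unpickle n : option (rat * rat)) is Some (a, b)
  then if a < b then Em i a `&` Ep i b else set0 else set0).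

Lemma level_bad_null i : measurable (level_bad i) /\ P (level_bad i) = 0%E.
Proof.
have mF n : measurable (if (unpickle n : option (rat * rat)) is Some (a, b)
  then if a < b then Em i a `&` Ep i b else set0 else set0).
  case: (unpickle n) => // -[a b]; case: ifPn => // _; apply: measurableI; [exact: mEm|exact: mEp].
split; first exact: bigcupT_measurable.
apply: null_bigcup => // n; case: (unpickle n) => [[a b]|]; last exact: measure0.
by case: ifPn => [|_]; [exact: Emp0|exact: measure0].
Qed.

Lemma level_inf_between i w (a b : rat) : ~ level_bad i w -> Ep i a w -> Em i b w ->
  ratr a <= fine (level_inf i w) <= ratr b.
Proof.
move=> nb Ea Eb.
have le : ((ratr a)%:E <= level_inf i w)%E.
  apply: le_ereal_inf_tmp => _ [c Ec <-]; rewrite lee_fin ler_rat leNgt.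
  apply/negP => ca; apply: nb; exists (pickle (c, a)); first exact: Logic.I.
  by rewrite pickleK ca; split.
have ge : (level_inf i w <= (ratr b)%:E)%E by apply: ereal_inf_lbound; exists b.
by move: le ge; case: (level_inf i w) => [r||]//=; rewrite !lee_fin => -> ->.
Qed.

(** Up to a tail of [nu], the range of [y_i] is cut into finitely many cells of rational length
    [r < e]. Off finitely many null events, [y_i] and [level_inf i w] lie in the same cell. *)
Lemma exists_on_graph : exists2 T : W -> Rd R d, measurable_fun setT T & on_graph L T.
Proof.
exists level_map; first exact: measurable_level_map.
move=> e e0.
suff H i : plan_null L [set s : W * V | e < `|s.2 ord0 i - fine (level_inf i s.1)|].
  apply: (plan_nullS pL _ (plan_null_bigU pL (index_enum 'I_d) H)) => s [i Hi].
  by rewrite -bigcup_seq; exists i; rewrite /= ?mem_index_enum//; move: Hi; rewrite mxE.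
have [r] := rat_in_itvoo e0; rewrite in_itv/= => /andP[r0 re].
apply: (plan_null_le pL) => dl dl0.
have [N HN] := snd_tail dl0.
(* [M] cells of length [r] starting at [- N] cover the interval from [- N] to [N]. *)
pose M := (Num.bound ((N%:R + N%:R) / (ratr r : R))).+1.
pose al (j : nat) : rat := - N%:R + j%:R * r.
have alE j : ratr (al j) = - N%:R + j%:R * ratr r :> R.
  by rewrite /al rmorphD rmorphN rmorphM/= !ratr_nat.
pose Z := \big[setU/set0]_(j <- iota 0 M)
   ([set s : W * V | ~ Em i (al j.+1) s.1 /\ s.2 ord0 i <= ratr (al j.+1)] `|`
    [set s : W * V | ~ Ep i (al j) s.1 /\ ratr (al j) <= s.2 ord0 i]).
have [mb b0] := level_bad_null i.
have ZN : plan_null L (Z `|` fst @^-1` level_bad i).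
  apply: (plan_nullU pL); last exact: (plan_null_fst pL).
  by apply: (plan_null_bigU pL) => j; apply: (plan_nullU pL).
apply: le_trans HN; rewrite -[leRHS]addr0 -ZN.
apply: le_trans (plan_indicU pL _ _); apply: (plan_indic_le pL) => s /= Hs.
have [|yN] := ltP N%:R `|s.2 ord0 i|; [by left; exists i|right].
have [|nb] := pselect (level_bad i s.1); [by right|left].
apply: contrapT => nZ.
set y := s.2 ord0 i in Hs yN *.
have rr : 0 < ratr r :> R by [].
have y0 : 0 <= (y + N%:R) / ratr r.
  by rewrite divr_ge0 ?(ltW rr)//; move: yN; rewrite ler_norml => /andP[]; lra.
pose j := Num.truncn ((y + N%:R) / ratr r).
have /andP[j1 j2] := truncn_itv y0; rewrite -/j in j1 j2.
have jM : (j < M)%N.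
  rewrite /M ltnS -(ler_nat R) (le_trans j1)// ltW//; apply: le_lt_trans (archi_boundP _).
    by rewrite ler_pM2r ?invr_gt0// lerD2r; move: yN; rewrite ler_norml => /andP[].
  by rewrite divr_ge0 ?addr_ge0// ltW.
move: j1 j2; rewrite ler_pdivlMr// ltr_pdivrMr// => j1 j2.
have a1 : ratr (al j) <= y by rewrite alE; lra.
have a2 : y <= ratr (al j.+1) by rewrite alE; lra.
have E1 : Em i (al j.+1) s.1.
  apply: contrapT => nE; apply: nZ; rewrite /Z -bigcup_seq; exists j; last by left.
  by change (j \in iota 0 M); rewrite mem_iota.
have E2 : Ep i (al j) s.1.
  apply: contrapT => nE; apply: nZ; rewrite /Z -bigcup_seq; exists j; last by right.
  by change (j \in iota 0 M); rewrite mem_iota.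
have /andP[t1 t2] := level_inf_between nb E2 E1.
move: Hs; apply/negP; rewrite -leNgt ler_norml.
move: a1 a2 t1 t2; rewrite !alE -natr1; move: re rr; nra.
Qed.

End GraphFromLevels.

(** * Optimal plans are carried by graphs *)

Section ProductProbability.
Local Open Scope ereal_scope.
Context {d1 d2} {T1 : measurableType d1} {T2 : measurableType d2} {R : realType}.
Variables (mu : probability T1 R) (q : probability T2 R).

Definition prod_prob : set (T1 * T2) -> \bar R := (mu \x q).

HB.instance Definition _ := Measure.on prod_prob.

Lemma prod_prob_setT : prod_prob setT = 1.
Proof.
rewrite /prod_prob -setXTT product_measure1E//.
by have := probability_setT mu; have := probability_setT q => /= -> ->; rewrite mule1.
Qed.

HB.instance Definition _ := Measure_isProbability.Build _ _ _ prod_prob prod_prob_setT.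

Lemma prod_prob_null (E : set (T1 * T2)) : measurable E ->
  (forall x, q (xsection E x) = 0) -> prod_prob E = 0.
Proof.
move=> mE E0; rewrite /prod_prob /product_measure1 /=.
by rewrite integral0_eq// => x _; exact: E0.
Qed.

End ProductProbability.

Section InnerAlgebra.
Context {R : realType} {d : nat}.
Notation V := 'rV[R]_d.
Implicit Types x y z : V.

Lemma innerC x y : inner x y = inner y x.
Proof. by apply: eq_bigr => i _; rewrite mulrC. Qed.

Lemma innerDl x y z : inner (x + y) z = inner x z + inner y z.
Proof. by rewrite /inner -big_split; apply: eq_bigr => i _; rewrite mxE mulrDl. Qed.

Lemma innerZl k x z : inner (k *: x) z = k * inner x z.
Proof. by rewrite /inner mulr_sumr; apply: eq_bigr => i _; rewrite mxE mulrA. Qed.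

Lemma innerBl x y z : inner (x - y) z = inner x z - inner y z.
Proof. by rewrite innerDl -scaleN1r innerZl mulN1r. Qed.

Lemma innerDr x y z : inner x (y + z) = inner x y + inner x z.
Proof. by rewrite innerC innerDl !(innerC _ x). Qed.

Lemma innerBr x y z : inner x (y - z) = inner x y - inner x z.
Proof. by rewrite innerC innerBl !(innerC _ x). Qed.

Lemma innerZr k x z : inner x (k *: z) = k * inner x z.
Proof. by rewrite innerC innerZl innerC. Qed.

Lemma sqnorm_ge0 x : 0 <= sqnorm x.
Proof. by apply: sumr_ge0 => i _; rewrite -expr2 sqr_ge0. Qed.

Lemma inner_le_sqnorm x y : `|inner x y| <= 2^-1 * (sqnorm x + sqnorm y).
Proof.
have := sqnorm_ge0 (x - y); have := sqnorm_ge0 (x + y).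
rewrite /sqnorm !innerBl !innerBr !innerDl !innerDr (innerC y x) ler_norml.
by move=> h1 h2; apply/andP; split; lra.
Qed.

End InnerAlgebra.

(** * Level events of a sequence of small slacks *)

Section Levels.
Context {R : realType} {d : nat}.
Notation V := 'rV[R]_d.
Notation W := (Rd R d * Rd R d)%type.
Variables (mu q nu : probability (Rd R d) R).
Hypothesis qs : no_mass_small_sets q.
Notation P := (prod_prob mu q).
Variables (L : (W * V -> R) -> R) (pL : plan P nu L).

(** For [G w = phi w + <x, b x>] this is the constraint minus the cost. The drift is written as a
    shift of [z], so that for fixed [x] only the term [<y, z>] ties [y] to [z]. *)
Definition slack (G : W -> R) (b : V -> V) (chi : V -> R) (s : W * V) : R :=
  G s.1 + chi s.2 - inner s.2 ((s.1.2 : V) + b s.1.1).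

Variables (G : nat -> W -> R) (b : nat -> Rd R d -> Rd R d) (chi : nat -> V -> R).
Hypothesis mG : forall n, measurable_fun setT (G n).
Hypothesis mb : forall n, measurable_fun setT (b n).
Notation sl n := (slack (G n) (b n) (chi n)).
Hypothesis sl0 : forall n s, 0 <= sl n s.
Hypothesis dsl : forall n, plan_dom P nu (sl n).
Hypothesis Lsl : forall n, L (sl n) <= (4^-1) ^+ n.

Definition level1 (B : set V) n : set W := [set w | exists2 y, B y & sl n (w, y) < (2^-1) ^+ n].

(* Off [level B] the plan gives no mass to [B]; when a is below c, the levels of
   {y_i <= a} and {y_i >= c} are essentially disjoint, which determines y_i from w. *)
Definition level (B : set V) : set W := \bigcup_m \bigcap_(n >= m) level1 B n.

(** The set is a projection along an arbitrary [B]. It is Borel because the existence of [y] says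
    that a supremum of affine functions, evaluated at [z + b x], exceeds a measurable function of
    [w]. *)
Lemma measurable_level1 B n : measurable (level1 B n).
Proof.
pose F (x : Rd R d) := ereal_sup [set ((inner x y)%:E - (chi n y)%:E)%E | y in B].
have mF : measurable_fun setT F by exact: (measurable_sup_affine B id (EFin \o chi n)).
pose h (w : W) : Rd R d := (w.2 : V) + (b n w.1 : V).
have mh : measurable_fun setT h.
  apply: measurable_RdD; first exact: measurable_snd.
  by apply: measurableT_comp => //; exact: measurable_fst.
have -> : level1 B n = [set w | ((G n w - (2^-1) ^+ n)%:E < F (h w))%E].
  apply/seteqP; split => [w [y By Hy]|w /= /ereal_sup_gt[_ [y By <-]]].
    apply: (@lt_le_trans _ _ ((inner (h w) y)%:E - (chi n y)%:E)%E); last first.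
      by apply: ereal_sup_ubound; exists y.
    rewrite -EFinB lte_fin; move: Hy; rewrite /slack /= innerC -/(h w); lra.
  rewrite -EFinB lte_fin => Hy; exists y => //; move: Hy.
  by rewrite /slack /= innerC -/(h w); lra.
rewrite -[X in measurable X]setTI; apply: emeasurable_fun_lt => //.
- apply/measurable_EFinP; apply: measurable_funB => //.
- exact: measurableT_comp.
Qed.

Lemma measurable_level B : measurable (level B).
Proof.
by apply: bigcupT_measurable => m; apply: bigcap_measurableType => n _; exact: measurable_level1.
Qed.

Lemma levelS B C : B `<=` C -> level B `<=` level C.
Proof.
move=> BC w [m _ H]; exists m => // n mn; have [y By ?] := H n mn.
by exists y => //; exact: BC.
Qed.

(** Markov's inequality: outside [level1 B n] every [y] in [B] has slack at least [2^-n], while the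
    expected slack is at most [4^-n]. *)
Lemma plan_level1_le B n : L (\1_[set s : W * V | ~ level1 B n s.1 /\ B s.2]) <= (2^-1) ^+ n.
Proof.
apply: (@le_trans _ _ (L (fun s => 2 ^+ n * sl n s))).
  apply: (plan_le pL); [exact: plan_dom_indic|exact: plan_domZ|move=> s].
  rewrite indicE; case: (boolP (_ \in _)) => [|_]; last by rewrite mulr_ge0// exprn_ge0.
  rewrite inE => -[Hl Bs] /=; rewrite -ler_pdivrMl ?exprn_gt0// mulr1 -exprVn leNgt.
  by apply/negP => H; apply: Hl; exists s.2 => //; rewrite -surjective_pairing.
rewrite (planZ pL)//; apply: le_trans (ler_wpM2l _ (Lsl n)) _; first by rewrite exprn_ge0.
by rewrite -exprMn_comm; [rewrite (_ : 2 * 4^-1 = 2^-1)//; lra|exact: mulrC].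
Qed.

(** A Borel-Cantelli argument in which countable additivity is borrowed from [P]. *)
Lemma plan_level_null B : plan_null L [set s : W * V | ~ level B s.1 /\ B s.2].
Proof.
apply: (plan_null_le pL) => e e0.
have e2 : 0 < e / 2 by rewrite divr_gt0.
have [m Hm] : exists m, 2 * (2^-1) ^+ m <= e / 2 :> R.
  exists (Num.bound (4 / e)); rewrite exprVn ler_pdivrMr ?exprn_gt0//.
  have H : 4 / e < (2 : R) ^+ Num.bound (4 / e).
    apply: lt_le_trans (archi_boundP _) _; first by rewrite divr_ge0// ltW.
    by rewrite -natrX ler_nat ltnW// ltn_expl.
  by move: H; rewrite ltr_pdivrMr//; lra.
(* Failures at the levels [m, ..., m + k - 1], whose bounds form a geometric sum. *)
pose S k := [set s : W * V | exists n, [/\ (m <= n < m + k)%N, ~ level1 B n s.1 & B s.2]].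
have HS k : L (\1_(S k)) <= 2 * (2^-1) ^+ m - 2 * (2^-1) ^+ (m + k).
  elim: k => [|k IH].
    rewrite addn0 subrr (_ : S 0%N = set0); last first.
      by apply/seteqP; split => // s [n []]; rewrite addn0 ltnNge => /andP[->].
    rewrite (_ : \1_set0 = fun s => 0 * \1_set0 s).
      by rewrite (planZ pL) ?mul0r//; exact: plan_dom_indic.
    by apply/funext => s; rewrite indic0 mul0r.
  apply: (@le_trans _ _ (L (\1_(S k)) + L (\1_[set s : W * V | ~ level1 B (m + k) s.1 /\ B s.2]))).
    apply: le_trans (plan_indicU pL _ _); apply: (plan_indic_le pL) => s [n [/andP[mn nk] H1 H2]].
    move: nk; rewrite addnS ltnS leq_eqVlt => /orP[/eqP nk|nk].
      by right; rewrite -nk.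
    by left; exists n; split => //; rewrite mn nk.
  by have := plan_level1_le B (m + k); rewrite addnS exprS; move: IH; lra.
(* The failures that occur only from level [m + k] on. They are events of [w] alone and decrease to
   the empty set, so continuity of [P] makes them small. *)
pose D k : set W := (\bigcup_(n >= m) ~` level1 B n) `&`
   \bigcap_(n in [set n | (m <= n < m + k)%N]) level1 B n.
have mD k : measurable (D k).
  apply: measurableI.
    by apply: bigcup_measurable => n _; apply: measurableC; exact: measurable_level1.
  by apply: bigcap_measurableType => n _; exact: measurable_level1.
have [||k] := continuity_above (m := P) _ mD _ e2.
- by rewrite [X in (X < _)%E](@probability_setT _ _ _ P) ltry.
- move=> k l kl; apply/subsetPset => w [Uw Hw]; split => // n /= /andP[mn nk].
  by apply: Hw => /=; rewrite mn (leq_trans nk)// leq_add2l.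
have -> : \bigcap_n D n = set0.
  apply/seteqP; split => // w Hw; have [[n /= mn nL] _] := Hw 0%N Logic.I.
  have [_ /(_ n)] := Hw (n - m).+1 Logic.I; apply: contra_not nL; apply.
  by rewrite /= mn addnS ltnS subnKC//=.
rewrite measure0 add0e => HD.
apply: (@le_trans _ _ (L (\1_(S k)) + L (\1_(fst @^-1` D k)))).
  apply: le_trans (plan_indicU pL _ _); apply: (plan_indic_le pL) => s [nl Bs].
  have [Sk|nS] := pselect (S k s); [by left|right; split].
    apply: contrapT => H; apply: nl; exists m => // n mn; apply: contrapT => nL.
    by apply: H; exists n.
  by move=> n /= mnk; apply: contrapT => nL; apply: nS; exists n.
rewrite (plan_indic_fst pL)//.
have : fine (P (D k)) <= e / 2 by rewrite -lee_fin fineK// fin_num_measure.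
have := HS k; have : 0 <= (2^-1 : R) ^+ (m + k) by rewrite exprn_ge0.
by move: Hm; lra.
Qed.

(** The bound [N] on all coordinates is what makes the cone constant of the sections finite. *)
Definition lower_box (N : nat) i (a : R) : set V :=
  [set y | (forall j, `|y ord0 j| <= N%:R) /\ y ord0 i <= a].
Definition upper_box (N : nat) i (a : R) : set V :=
  [set y | (forall j, `|y ord0 j| <= N%:R) /\ a <= y ord0 i].

Lemma slack_swap n x z1 z2 y1 y2 :
  sl n (x, z1, y1) + sl n (x, z2, y2) - sl n (x, z1, y2) - sl n (x, z2, y1)
  = inner (y1 - y2) (z2 - z1).
Proof. by rewrite /slack /= innerBl !innerBr !innerDr; ring. Qed.

(* For z1, z2 in the section, choose y1 in the upper box with small slack at z1 and
   y2 in the lower box with small slack at z2. The slacks of the swapped pairs are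
   nonnegative, so <y1 - y2, z2 - z1> is almost nonpositive by [slack_swap], while its
   i-th term is at least (c - a)(z2_i - z1_i) when z2_i >= z1_i. *)
Lemma level_section_cone N i (a c : R) x : a < c ->
  cone_set i (2 * N%:R / (c - a)) (xsection (level (lower_box N i a) `&` level (upper_box N i c)) x).
Proof.
move=> ac.
have ca : 0 < c - a by rewrite subr_gt0.
set E := xsection _ _.
suff H (z1 z2 : V) : E z1 -> E z2 -> z2 ord0 i - z1 ord0 i <=
    2 * N%:R / (c - a) * \sum_(j < d | j != i) `|z1 ord0 j - z2 ord0 j|.
  move=> z1 z2 E1 E2; rewrite ler_norml; apply/andP; split.
    by have := H _ _ E1 E2; lra.
  rewrite (eq_bigr (fun j => `|z2 ord0 j - z1 ord0 j|)); first exact: H.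
  by move=> j _; rewrite distrC.
rewrite /E /xsection /= => /set_mem[_ [m2 _ H2]] /set_mem[[m1 _ H1] _].
rewrite mulrAC ler_pdivlMr//.
set S := \sum_(j < d | _) _.
have S0 : 0 <= S by exact: sumr_ge0.
have [t0|t0] := leP (z2 ord0 i - z1 ord0 i) 0.
  by apply: (@le_trans _ _ 0); [rewrite mulr_le0_ge0// ltW|rewrite !mulr_ge0].
apply/ler_addgt0Pr => e e0.
have [k Hk] : exists k, 2 * (2^-1) ^+ k <= e :> R.
  exists (Num.bound (2 / e)); rewrite exprVn ler_pdivrMr ?exprn_gt0//.
  have H : 2 / e < (2 : R) ^+ Num.bound (2 / e).
    apply: lt_le_trans (archi_boundP _) _; first by rewrite divr_ge0// ltW.
    by rewrite -natrX ler_nat ltnW// ltn_expl.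
  by move: H; rewrite ltr_pdivrMr//; lra.
pose n := maxn (maxn m1 m2) k.
have [|y1 [y1N y1c] s1] := H2 n; first by rewrite /= /n !leq_max leqnn orbT.
have [|y2 [y2N y2a] s2] := H1 n; first by rewrite /= /n !leq_max leqnn.
have nk : (2^-1 : R) ^+ n <= (2^-1) ^+ k.
  by rewrite ler_wiXn2l// ?invr_ge0// ?invf_le1 ?ler1n// /n leq_max leqnn orbT.
have := slack_swap n x z1 z2 y1 y2.
have := sl0 n (x, z1, y2); have := sl0 n (x, z2, y1).
move=> g1 g2 sw.
have : inner (y1 - y2) (z2 - z1) <= e by rewrite -sw; lra.
rewrite /inner (bigD1 i)//= !mxE.
have : - (2 * N%:R * S) <= \sum_(j < d | j != i) (y1 - y2) ord0 j * (z2 - z1) ord0 j.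
  rewrite /S mulr_sumr -sumrN; apply: ler_sum => j _; rewrite !mxE.
  set u := y1 ord0 j - y2 ord0 j; rewrite (distrC (z1 ord0 j)); set v := z2 ord0 j - z1 ord0 j.
  have uN : `|u| <= 2 * N%:R.
    by apply: (le_trans (ler_normB _ _)); have := y1N j; have := y2N j; lra.
  rewrite lerNl; apply: le_trans (ler_norm _) _; rewrite normrN normrM.
  by rewrite ler_wpM2r.
have : (c - a) * (z2 ord0 i - z1 ord0 i) <= (y1 ord0 i - y2 ord0 i) * (z2 ord0 i - z1 ord0 i).
  by rewrite ler_wpM2r ?(ltW t0)//; lra.
by move=> *; lra.
Qed.

(** For each [N] the sections over [x] are cone sets, hence [q]-null, and Fubini concludes. The
    assumption on small sets acts here. *)
Lemma levels_disjoint i (a c : R) : a < c ->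
  P ((\bigcup_N level (lower_box N i a)) `&` (\bigcup_N level (upper_box N i c))) = 0%E.
Proof.
move=> ac; pose E N := level (lower_box N i a) `&` level (upper_box N i c).
have mE N : measurable (E N) by apply: measurableI; exact: measurable_level.
have E0 N : P (E N) = 0%E.
  apply: prod_prob_null => // x.
  apply: (cone_set_null qs _ (level_section_cone (N := N) ac)).
    by rewrite divr_ge0 ?mulr_ge0// subr_ge0 ltW.
  by apply: measurable_xsection; exact: (mE N).
rewrite -[RHS](null_bigcup mE E0).
congr (prod_prob _ _ _); apply/seteqP; split => [w [[N _ H1] [M _ H2]]|w [N _ [H1 H2]]]; last first.
  by split; exists N.
exists (maxn N M) => //; split; [apply: levelS H1|apply: levelS H2] => y [yN ya]; split => // j;
by apply: (le_trans (yN j)); rewrite ler_nat leq_max leqnn ?orbT.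
Qed.

Lemma bounded_levels_null (B : nat -> set V) (C : set V) :
  (forall N y, C y -> (forall j, `|y ord0 j| <= N%:R) -> B N y) ->
  plan_null L [set s : W * V | ~ (\bigcup_N level (B N)) s.1 /\ C s.2].
Proof.
move=> BC; apply: (plan_null_le pL) => e e0.
have [N HN] := snd_tail pL e0.
apply: le_trans HN; rewrite -[leRHS]addr0 -(plan_level_null (B N)).
apply: le_trans (plan_indicU pL _ _); apply: (plan_indic_le pL) => s [nl Cs].
have [|nt] := pselect (exists i, N%:R < `|s.2 ord0 i|); [by left|right; split].
  by move=> H; apply: nl; exists N.
by apply: BC => // j; rewrite leNgt; apply/negP => H; apply: nt; exists j.
Qed.

Lemma optimal_on_graph : exists2 T : W -> Rd R d, measurable_fun setT T & on_graph L T.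
Proof.
apply: (exists_on_graph pL (Em := fun i a => \bigcup_N level (lower_box N i (ratr a)))
  (Ep := fun i a => \bigcup_N level (upper_box N i (ratr a)))).
- by move=> i a; apply: bigcupT_measurable => N; exact: measurable_level.
- by move=> i a; apply: bigcupT_measurable => N; exact: measurable_level.
- move=> i a; apply: (@bounded_levels_null (fun N => lower_box N i (ratr a)) [set y | y ord0 i <= ratr a]).
  by move=> N y.
- move=> i a; apply: (@bounded_levels_null (fun N => upper_box N i (ratr a)) [set y | ratr a <= y ord0 i]).
  by move=> N y.
- by move=> i a c ac; apply: levels_disjoint; rewrite ltr_rat.
Qed.

End Levels.

(** * Iterated integrals, suprema of affine functions, moments *)

Section FubiniReal.
Context {d1 d2} {T1 : measurableType d1} {T2 : measurableType d2} {R : realType}.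
Variables (mu : probability T1 R) (q : probability T2 R).

Lemma rintegral_fubini (phi : T1 * T2 -> R) : rintegrable (prod_prob mu q) phi ->
  [/\ {ae mu, forall x, rintegrable q (fun z => phi (x, z))},
      rintegrable mu (fun x => \int[q]_z phi (x, z))
    & \int[prod_prob mu q]_w phi w = \int[mu]_x \int[q]_z phi (x, z)].
Proof.
move=> Ip; have Ip' : (mu \x q)%E.-integrable setT (EFin \o phi) by exact: Ip.
have IF := integrable_fubini_F Ip'; have /measurable_int mF := IF.
have aeF := integrable_ae measurableT IF.
have mPhi : measurable_fun setT (fun x => \int[q]_z phi (x, z)).
  by apply: (measurableT_comp (fine_measurable measurableT) mF).
split; first exact: ae_integrable1 Ip'.
  apply: le_integrable IF => //; first exact/measurable_EFinP.
  move=> x _; rewrite /= /Rintegral -/(fubini_F q (EFin \o phi) x).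
  by case: (fubini_F _ _ _) => [r||]//=; rewrite normr0 leey.
rewrite /Rintegral; congr fine.
transitivity (\int[mu]_x fubini_F q (EFin \o phi) x)%E.
  exact/esym/integral12_prod_meas1.
apply: ae_eq_integral => //; first exact/measurable_EFinP.
by apply: filterS aeF => x /(_ I) fin _ ; rewrite /= fineK.
Qed.

Lemma prod_prob_fst (B : set T1) : measurable B -> prod_prob mu q (fst @^-1` B) = mu B.
Proof.
move=> mB; rewrite /prod_prob (_ : fst @^-1` B = B `*` setT) ?product_measure1E//.
  by have := probability_setT q => /= ->; rewrite mule1.
by apply/seteqP; split => [x|x []].
Qed.

Lemma prod_prob_snd (B : set T2) : measurable B -> prod_prob mu q (snd @^-1` B) = q B.
Proof.
move=> mB; rewrite /prod_prob (_ : snd @^-1` B = setT `*` B) ?product_measure1E//.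
  by have := probability_setT mu => /= ->; rewrite mul1e.
by apply/seteqP; split => [x|x []].
Qed.

End FubiniReal.

Section RintegralLinear.
Context {dT} {T : measurableType dT} {R : realType} (m : probability T R).

Lemma Rintegral_lin k (f g : T -> R) : rintegrable m f -> rintegrable m g ->
  \int[m]_x (k * f x + g x) = k * \int[m]_x f x + \int[m]_x g x.
Proof.
move=> If Ig; rewrite RintegralD//; last exact: rintegrableZ.
by rewrite RintegralZl.
Qed.

Lemma Rintegral_cstP (k : R) : \int[m]_x k = k.
Proof. by rewrite Rintegral_cst//; have := probability_setT m => /= ->; rewrite mulr1. Qed.

Lemma rintegralE (f : T -> R) : rintegrable m f -> (\int[m]_x (f x)%:E)%E = (\int[m]_x f x)%:E.
Proof. by move=> If; rewrite /Rintegral fineK//; apply: integrable_fin_num. Qed.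

(** Mass one makes the conull set nonempty: this gives suprema over [X] a nonempty index set and
    integrable functions a point of finiteness. *)
Lemma ae_setP (A : T -> Prop) : {ae m, forall x, A x} ->
  exists X, [/\ measurable X, m (~` X) = 0%E, X !=set0 & forall x, X x -> A x].
Proof.
move=> [N [mN N0 sN]]; exists (~` N); split; first exact: measurableC.
- by rewrite setCK.
- apply/set0P/eqP => N0'; have : m setT = 0%E by rewrite -N0 -[N]setCK N0' setC0.
  by rewrite probability_setT => /eqP; rewrite onee_eq0.
- by move=> x Nx; apply: contrapT => nA; apply: Nx; exact: sN.
Qed.

Lemma ae_set (A : T -> Prop) X : measurable X -> m (~` X) = 0%E ->
  (forall x, X x -> A x) -> {ae m, forall x, A x}.
Proof.
move=> mX X0 XA; exists (~` X); split => //; first exact: measurableC.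
by move=> x /= nA Xx; apply: nA; exact: XA.
Qed.

End RintegralLinear.

Section SupAffine.
Context {R : realType} {d : nat}.
Notation V := 'rV[R]_d.

Definition sup_affine {I : Type} (B : set I) (a : I -> V) (c : I -> R) (y : V) : R :=
  sup [set inner y (a i) - c i | i in B].

Variables (I : Type) (B : set I) (a : I -> V) (c : I -> R) (M : V -> R).
Hypotheses (B0 : B !=set0) (BM : forall y i, B i -> inner y (a i) - c i <= M y).

Lemma sup_affine_has_sup y : has_sup [set inner y (a i) - c i | i in B].
Proof.
split; first by case: B0 => i Bi; exists (inner y (a i) - c i), i.
by exists (M y) => _ [i Bi <-]; exact: BM.
Qed.

Lemma sup_affine_ge y i : B i -> inner y (a i) - c i <= sup_affine B a c y.
Proof. by move=> Bi; apply: ub_le_sup; [exact: (sup_affine_has_sup y).2|exists i]. Qed.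

Lemma sup_affine_le y : sup_affine B a c y <= M y.
Proof. by apply: ge_sup; [exact: (sup_affine_has_sup y).1|move=> _ [i Bi <-]; exact: BM]. Qed.

Lemma sup_affine_convex : convex_fun (sup_affine B a c).
Proof.
move=> x y t /andP[t0 t1]; apply: ge_sup; first exact: (sup_affine_has_sup _).1.
move=> _ [i Bi <-]; rewrite innerDl !innerZl.
have hx := ler_wpM2l t0 (sup_affine_ge x Bi).
have t1' : 0 <= 1 - t by rewrite subr_ge0.
have hy := ler_wpM2l t1' (sup_affine_ge y Bi).
by nra.
Qed.

Lemma sup_affine_measurable : measurable_fun setT (sup_affine B a c : Rd R d -> R).
Proof.
apply/measurable_EFinP.
rewrite (_ : EFin \o sup_affine B a c =
  fun y => ereal_sup [set ((inner y (a i))%:E - (c i)%:E)%E | i in B]).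
  exact: measurable_sup_affine.
apply/funext => y; rewrite /= /sup_affine -ereal_sup_EFin.
- congr ereal_sup; apply/seteqP; split => [_ [_ [i Bi <-] <-]|_ [i Bi <-]]; first by exists i.
  by exists (inner y (a i) - c i) => //; exists i.
- exact: (sup_affine_has_sup y).2.
- exact: (sup_affine_has_sup y).1.
Qed.

End SupAffine.

Section Moments.
Context {R : realType} {d : nat}.
Notation V := 'rV[R]_d.
Variable rho : probability (Rd R d) R.
Hypothesis rho2 : finite_second_moment rho.

Lemma rintegrable_sqnorm : rintegrable rho (fun y : Rd R d => sqnorm y).
Proof.
apply/integrableP; split.
  by apply/measurable_EFinP; apply: measurable_inner; exact: measurable_id.
move: rho2; rewrite /finite_second_moment.
apply: le_lt_trans; apply: integral_mono => y.
by rewrite /= ger0_norm ?sqnorm_ge0.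
Qed.

Lemma coord_le_sqnorm (y : V) i : y ord0 i ^+ 2 <= sqnorm y.
Proof.
rewrite /sqnorm /inner (bigD1 i)//= -expr2 lerDl sumr_ge0// => j _.
by rewrite -expr2 sqr_ge0.
Qed.

Lemma rintegrable_coord_sqr i : rintegrable rho (fun y : Rd R d => (y : V) ord0 i ^+ 2).
Proof.
apply: rintegrable_le rintegrable_sqnorm _.
  by apply: measurable_funX; exact: measurable_coord.
by move=> y; rewrite ger0_norm ?sqr_ge0// coord_le_sqnorm.
Qed.

Lemma rintegrable_coord i : rintegrable rho (fun y : Rd R d => (y : V) ord0 i).
Proof.
apply: (@rintegrable_le _ _ _ _ _ (fun y : Rd R d => 1 + (y : V) ord0 i ^+ 2)).
- exact: measurable_coord.
- by apply: rintegrableD; [exact: rintegrable_cst|exact: rintegrable_coord_sqr].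
- move=> y; rewrite ler_norml.
  have := sqr_ge0 ((y : V) ord0 i - 1); have := sqr_ge0 ((y : V) ord0 i + 1).
  by move=> *; apply/andP; split; nra.
Qed.

Lemma rintegrable_inner_l (a : V) : rintegrable rho (fun y : Rd R d => inner y a).
Proof.
apply: (@rintegrable_le _ _ _ _ _ (fun y : Rd R d => 2^-1 * sqnorm y + 2^-1 * sqnorm a)).
- by apply: measurable_inner; [exact: measurable_id|exact: measurable_cst].
- apply: rintegrableD; last exact: rintegrable_cst.
  by apply: rintegrableZ; exact: rintegrable_sqnorm.
- by move=> y; rewrite -mulrDr inner_le_sqnorm.
Qed.

End Moments.

(** * The linear program and its dual *)

Section Program.
Context {R : realType} {d : nat}.
Notation V := 'rV[R]_d.
Notation W := (Rd R d * Rd R d)%type.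
Variables (mu nu q : probability (Rd R d) R).
Hypotheses (mu2 : finite_second_moment mu) (nu2 : finite_second_moment nu)
  (q2 : finite_second_moment q).
Notation P := (prod_prob mu q).

Definition cost (s : W * V) : R := inner s.2 s.1.2.

Definition bounded_field (b : Rd R d -> Rd R d) :=
  measurable_fun setT b /\ exists C, forall x i, `|(b x : V) ord0 i| <= C.

Definition constraint (phi : W -> R) (chi : Rd R d -> R) (b : Rd R d -> Rd R d) (s : W * V) : R :=
  phi s.1 + chi s.2 + inner ((s.1.1 : V) - s.2) (b s.1.1).

(* The dual side of the linear program over the joint laws of (X, Z, Y) with
   (X, Z) distributed as P, Y distributed as nu and E[Y | X] = X. *)
Definition program : set ((W * V -> R) * R) := [set p | exists phi chi b,
  [/\ rintegrable P phi, rintegrable nu chi, bounded_field b &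
      p = (constraint phi chi b, \int[P]_w phi w + \int[nu]_y chi y)]].

Lemma bounded_field0 : bounded_field (fun=> 0).
Proof. by split; [exact: measurable_cst|exists 0 => x i; rewrite mxE normr0]. Qed.

Lemma constraintE phi chi s : constraint phi chi (fun=> 0) s = phi s.1 + chi s.2.
Proof. by rewrite /constraint [inner _ 0]big1 ?addr0// => i _; rewrite !mxE mulr0. Qed.

Lemma program_linear : linear_graph program.
Proof.
move=> k _ _ _ _ [p1 [c1 [b1 [I1 J1 [m1 [C1 B1]] [-> ->]]]]] [p2 [c2 [b2 [I2 J2 [m2 [C2 B2]] [-> ->]]]]].
exists (fun w => k * p1 w + p2 w), (fun y => k * c1 y + c2 y),
  (fun x => k *: (b1 x : V) + (b2 x : V)); split.
- by apply: rintegrableD => //; exact: rintegrableZ.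
- by apply: rintegrableD => //; exact: rintegrableZ.
- split.
    apply: measurable_fun_Rd => i.
    under eq_fun do rewrite !mxE.
    apply: measurable_funD; last exact: measurable_coord_comp.
    by apply: measurable_funM => //; exact: measurable_coord_comp.
  exists (`|k| * C1 + C2) => x i; rewrite !mxE.
  by apply: (le_trans (ler_normD _ _)); rewrite normrM lerD// ler_wpM2l.
- congr pair; last by rewrite !Rintegral_lin//; ring.
  by apply/funext => s; rewrite /constraint innerDr innerZr; ring.
Qed.

Lemma program_mem phi chi : rintegrable P phi -> rintegrable nu chi ->
  program (fun s => phi s.1 + chi s.2, \int[P]_w phi w + \int[nu]_y chi y).
Proof.
move=> Ip Ic; exists phi, chi, (fun=> 0); split => //; first exact: bounded_field0.
by congr pair; apply/funext => s; rewrite constraintE.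
Qed.

Lemma program0 : program (fun=> 0, 0).
Proof.
have := program_mem (rintegrable_cst P 0) (rintegrable_cst nu 0).
by rewrite !Rintegral_cst// !mul0r addr0.
Qed.

Lemma program_dominated h : plan_dom P nu h -> dominated program h.
Proof.
move=> [phi [chi [Ip Ic hle]]]; exists (fun s => phi s.1 + chi s.2), (\int[P]_w phi w + \int[nu]_y chi y).
by split => //; exact: program_mem.
Qed.

(** Averaging the nonnegative constraint over [q] leaves, for almost every [x], an affine function
    of [y] below [chi]. The supremum [psi] of these is convex, stays below [chi], and dominates
    [- Phi] at [y = x]; convex order compares the two integrals of [psi]. *)
Lemma program_positive : convex_order mu nu -> positive_graph program.
Proof.
move=> cvx _ _ [phi [chi [b [Ip Ic [mb [C bC]] [-> ->]]]]] pos.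
have [aeI IPhi ->] := rintegral_fubini Ip.
set Phi := (fun x => \int[q]_z phi (x, z)) in IPhi *.
have [X [mX X0 Xne XI]] := ae_setP aeI.
pose c x := inner x (b x) + Phi x.
have key y x : X x -> inner y (b x) - c x <= chi y.
  move=> Xx; have Iq := XI _ Xx.
  suff : 0 <= Phi x + (chi y + inner (x - y) (b x)) by rewrite /c innerBl; lra.
  have -> : Phi x + (chi y + inner (x - y) (b x)) =
      \int[q]_z (phi (x, z) + (chi y + inner (x - y) (b x))).
    rewrite RintegralD//; last exact: rintegrable_cst.
    by rewrite Rintegral_cstP.
  by apply: Rintegral_ge0 => z _; have := pos ((x, z), y); rewrite /constraint /= addrA.
(* Only those [x] enter for which [phi] is integrable along the section. *)
pose psi := sup_affine X (b : V -> V) c.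
have psiX x : X x -> - Phi x <= psi x.
  by move=> Xx; have := sup_affine_ge Xne key x Xx; rewrite /psi /c; lra.
have h1 : ((- \int[mu]_x Phi x)%:E <= \int[mu]_x (psi x)%:E)%E.
  rewrite EFinN -rintegralE// -integralN; last by apply: integrable_add_def.
  apply: ae_le_integral_l.
    by apply: measurableT_comp => //; apply/measurable_EFinP; exact: rintegrable_measurable IPhi.
  by apply: (ae_set mX X0) => x Xx; rewrite -EFinN lee_fin psiX.
have h2 : (\int[nu]_x (psi x)%:E <= (\int[nu]_x chi x)%:E)%E.
  rewrite -rintegralE//; apply: integral_mono => y; rewrite lee_fin.
  exact: (sup_affine_le Xne key).
have := le_trans h1 (le_trans (cvx psi (sup_affine_convex Xne key)) h2).
by rewrite lee_fin; lra.
Qed.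

Lemma rintegrable_sqnorm_fst : rintegrable P (fun w => sqnorm w.1).
Proof.
exact: (integrable_image measurable_fst (prod_prob_fst mu q) (rintegrable_sqnorm mu2)).
Qed.

Lemma rintegrable_sqnorm_snd : rintegrable P (fun w => sqnorm w.2).
Proof.
exact: (integrable_image measurable_snd (prod_prob_snd mu q) (rintegrable_sqnorm q2)).
Qed.

Lemma sqnorm_bounded_field b C (x : Rd R d) :
  (forall x i, `|(b x : V) ord0 i| <= C) -> sqnorm (b x) <= d%:R * C ^+ 2.
Proof.
move=> bC; rewrite /sqnorm /inner mulr_natl -[X in _ *+ X]card_ord -sumr_const.
apply: ler_sum => i _; rewrite -expr2 -real_normK ?num_real//.
by rewrite ler_sqr ?nnegrE// (le_trans _ (bC x i)).
Qed.

Lemma plan_dom_cost : plan_dom P nu cost.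
Proof.
exists (fun w => 2^-1 * sqnorm w.2), (fun y => 2^-1 * sqnorm y); split.
- exact: (rintegrableZ _ rintegrable_sqnorm_snd).
- exact: (rintegrableZ _ (rintegrable_sqnorm nu2)).
- by move=> s; rewrite /cost addrC -mulrDr inner_le_sqnorm.
Qed.

Lemma plan_dom_drift b : bounded_field b ->
  plan_dom P nu (fun s => inner ((s.1.1 : V) - s.2) (b s.1.1)).
Proof.
move=> [mb [C bC]].
exists (fun w => 2^-1 * sqnorm w.1 + d%:R * C ^+ 2), (fun y => 2^-1 * sqnorm y); split.
- apply: rintegrableD; last exact: rintegrable_cst.
  exact: (rintegrableZ _ rintegrable_sqnorm_fst).
- exact: (rintegrableZ _ (rintegrable_sqnorm nu2)).
- move=> s; rewrite innerBl; apply: (le_trans (ler_normB _ _)).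
  have := inner_le_sqnorm s.1.1 (b s.1.1); have := inner_le_sqnorm s.2 (b s.1.1).
  by have := sqnorm_bounded_field s.1.1 bC; lra.
Qed.

Definition martingale_plan L := plan P nu L /\ forall b, bounded_field b ->
  L (fun s => inner ((s.1.1 : V) - s.2) (b s.1.1)) = 0.

Lemma constraint_ext phi chi b : constraint phi chi b =
  fun s => (phi s.1 + chi s.2) + inner ((s.1.1 : V) - s.2) (b s.1.1).
Proof. by []. Qed.

Lemma plan_dom_constraint phi chi b : rintegrable P phi -> rintegrable nu chi ->
  bounded_field b -> plan_dom P nu (constraint phi chi b).
Proof.
move=> Ip Ic bb; rewrite constraint_ext; apply: plan_domD; last exact: plan_dom_drift.
by apply: plan_domD; [exact: plan_dom_fst|exact: plan_dom_snd].
Qed.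

Lemma martingale_plan_constraint L phi chi b : martingale_plan L ->
  rintegrable P phi -> rintegrable nu chi -> bounded_field b ->
  L (constraint phi chi b) = \int[P]_w phi w + \int[nu]_y chi y.
Proof.
move=> [pL mL] Ip Ic bb; rewrite constraint_ext (planD pL); last exact: plan_dom_drift.
  rewrite mL// addr0 (planD pL); [|exact: plan_dom_fst|exact: plan_dom_snd].
  by rewrite (plan_fst pL)// (plan_snd pL).
by apply: plan_domD; [exact: plan_dom_fst|exact: plan_dom_snd].
Qed.

Definition feasible phi chi b := [/\ rintegrable P phi, rintegrable nu chi, bounded_field b
  & forall s, cost s <= constraint phi chi b s].

(** Optimality is certified by dual triples of nearly the same value, the form in which it produces
    small slacks. *)
Definition optimal_plan L := martingale_plan L /\
  forall e, 0 < e -> exists phi chi b, feasible phi chi b /\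
    \int[P]_w phi w + \int[nu]_y chi y <= L cost + e.

Lemma plan_of_extension U L : positive_extension U L ->
  (forall h, plan_dom P nu h -> dominated U h) ->
  (forall phi chi, rintegrable P phi -> rintegrable nu chi ->
     U (fun s => phi s.1 + chi s.2, \int[P]_w phi w + \int[nu]_y chi y)) ->
  plan P nu L.
Proof.
move=> [lin pos ext] dom UL; split.
- by move=> k f g df dg; apply: lin; exact: dom.
- by move=> f df; apply: pos; exact: dom.
- move=> phi Ip; have := ext _ _ (UL _ _ Ip (rintegrable_cst nu 0)).
  rewrite Rintegral_cst// mul0r addr0 => <-; congr L.
  by apply/funext => s; rewrite addr0.
- move=> chi Ic; have := ext _ _ (UL _ _ (rintegrable_cst P 0) Ic).
  rewrite Rintegral_cst// mul0r add0r => <-; congr L.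
  by apply/funext => s; rewrite add0r.
Qed.

Lemma exists_optimal_plan : convex_order mu nu -> exists L, optimal_plan L.
Proof.
move=> cvx.
have [L [ext opt]] := riesz_extension program_linear program0 (program_positive cvx)
  (program_dominated plan_dom_cost).
exists L; split; first split.
- apply: (plan_of_extension ext); first exact: program_dominated.
  exact: program_mem.
- move=> b bb; have [_ _] := ext; move=> /(_ (constraint (fun=> 0) (fun=> 0) b)).
  move=> /(_ (\int[P]_w 0 + \int[nu]_y 0)) H.
  transitivity (\int[P]_w (0:R) + \int[nu]_y (0:R)).
    rewrite -H; first by congr L; apply/funext => s; rewrite /constraint !add0r.
    by exists (fun=> 0), (fun=> 0), b; split => //; exact: rintegrable_cst.
  by rewrite !Rintegral_cst// !mul0r addr0.
- move=> e e0; have [u [v [[phi [chi [b [Ip Ic bb [-> ->]]]]] cu vL]]] := opt e e0.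
  by exists phi, chi, b; split.
Qed.

(** By construction [conj psi (b x + z) <= <x, b x> + phi (x, z)]. Averaging over [q] and testing
    the outer conjugate at [b x] bounds it below at [x] by minus the [q]-average of [phi (x, z)]. *)
Lemma feasible_dual_le phi chi b : feasible phi chi b ->
  (Dq mu nu q <= (\int[P]_w phi w + \int[nu]_y chi y)%:E)%E.
Proof.
move=> [Ip Ic [mb [C bC]] cle].
pose c (w : W) := inner w.1 (b w.1) + phi w.
pose a (w : W) : V := (w.2 : V) + (b w.1 : V).
have key y w : [set: W] w -> inner y (a w) - c w <= chi y.
  move=> _; have := cle (w, y); rewrite /cost /constraint /a /c /= innerDr innerBl.
  by lra.
have Wne : [set: W] !=set0 by exists (0, 0).
pose psi := sup_affine [set: W] a c.
have Ipsi : rintegrable nu psi.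
  apply: (@rintegrable_le _ _ _ _ _
    (fun y : Rd R d => `|chi y| + (`|inner y (a (0, 0))| + `|c (0, 0)|))).
  - exact: (sup_affine_measurable Wne key).
  - apply: rintegrableD; first exact: rintegrable_norm.
    apply: rintegrableD; last exact: rintegrable_cst.
    by apply: rintegrable_norm; exact: rintegrable_inner_l.
  - move=> y; have h1 := sup_affine_le Wne key y.
    have h2 := @sup_affine_ge _ _ _ _ _ _ _ Wne key y (0, 0) Logic.I.
    have h3 := ler_norm (chi y); have h4 := ler_norm (c (0, 0)).
    have h5 := ler_norm (- inner y (a (0, 0))); rewrite normrN in h5.
    have h6 := normr_ge0 (chi y); have h7 := normr_ge0 (inner y (a (0, 0))).
    have h8 := normr_ge0 (c (0, 0)).
    by rewrite /psi ler_norml; apply/andP; split; lra.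
apply: (@le_trans _ _ (\int[nu]_y (psi y)%:E - \int[mu]_x conj (Defs.conv (conj (EFin \o psi)) q) x)%E).
  apply: ereal_inf_lbound; exists (EFin \o psi) => //; split; last exact: Ipsi.
  split => // x y t /andP[t0 t1]; rewrite -!EFinM -EFinD lee_fin.
  by apply: (sup_affine_convex Wne key); rewrite !ltW.
have [aeI IPhi ->] := rintegral_fubini Ip.
set Phi := (fun x => \int[q]_z phi (x, z)) in IPhi *.
have [X [mX X0 Xne XI]] := ae_setP aeI.
have h1 : ((- \int[mu]_x Phi x)%:E <= \int[mu]_x conj (Defs.conv (conj (EFin \o psi)) q) x)%E.
  rewrite EFinN -rintegralE// -integralN; last by apply: integrable_add_def.
  apply: ae_le_integral_l.
    by apply: measurableT_comp => //; apply/measurable_EFinP; exact: rintegrable_measurable IPhi.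
  apply: (ae_set mX X0) => x Xx; rewrite -EFinN.
  apply: (@le_trans _ _ ((inner x (b x))%:E - Defs.conv (conj (EFin \o psi)) q (b x))%E); last first.
    by apply: ereal_sup_ubound; exists (b x).
  have Iq := XI _ Xx.
  apply: (@le_trans _ _ ((inner x (b x))%:E - (inner x (b x) + Phi x)%:E)%E).
    by rewrite -EFinB lee_fin; lra.
  apply: leeB => //; rewrite /Defs.conv.
  have -> : (inner x (b x) + Phi x)%:E = (\int[q]_z (c (x, z))%:E)%E.
    rewrite rintegralE /c /=; last by apply: rintegrableD => //; exact: rintegrable_cst.
    rewrite RintegralD//; last exact: rintegrable_cst.
    by rewrite Rintegral_cstP.
  apply: integral_mono => z; apply: ge_ereal_sup => _ [y _ <-].
  rewrite /= -EFinB lee_fin.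
  have := @sup_affine_ge _ _ _ _ _ _ _ Wne key y (x, z) Logic.I.
  by rewrite /a /= -/psi (innerC (_ + _)) (addrC (b x : V)); lra.
have h2 : (\int[nu]_x (psi x)%:E <= (\int[nu]_x chi x)%:E)%E.
  rewrite -rintegralE//; apply: integral_mono => y; rewrite lee_fin.
  exact: (sup_affine_le Wne key).
apply: (le_trans (leeB h2 h1)).
by rewrite -EFinB lee_fin; lra.
Qed.

End Program.

(** * Weak duality *)

Section Couplings.
Context {R : realType} {d : nat}.
Notation V := 'rV[R]_d.
Variables (rho q : probability (Rd R d) R).
Hypotheses (rho2 : finite_second_moment rho) (q2 : finite_second_moment q).
Variables (g : probability (Rd R d * Rd R d)%type R) (cg : coupling rho q g).

Lemma coupling_fst B : measurable B -> g (fst @^-1` B) = rho B.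
Proof.
move=> mB; rewrite -(cg.1 _ mB); congr (g _).
by apply/seteqP; split => [x|x []].
Qed.

Lemma coupling_snd B : measurable B -> g (snd @^-1` B) = q B.
Proof.
move=> mB; rewrite -(cg.2 _ mB); congr (g _).
by apply/seteqP; split => [x|x []].
Qed.

Lemma integrable_coupling_fst (f : Rd R d -> \bar R) : rho.-integrable setT f ->
  g.-integrable setT (fun yz => f yz.1) /\ (\int[g]_yz f yz.1 = \int[rho]_y f y)%E.
Proof.
move=> If; have /measurable_int mf := If; split.
  exact: (integrable_image measurable_fst coupling_fst If).
exact: (integral_image measurable_fst coupling_fst mf).
Qed.

Lemma integrable_coupling_snd (f : Rd R d -> \bar R) : q.-integrable setT f ->
  g.-integrable setT (fun yz => f yz.2) /\ (\int[g]_yz f yz.2 = \int[q]_z f z)%E.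
Proof.
move=> If; have /measurable_int mf := If; split.
  exact: (integrable_image measurable_snd coupling_snd If).
exact: (integral_image measurable_snd coupling_snd mf).
Qed.

Lemma rintegrable_coupling_cost :
  rintegrable g (fun yz => inner yz.1 yz.2) /\
  - (2^-1 * (\int[rho]_y sqnorm y + \int[q]_z sqnorm z)) <= \int[g]_yz inner yz.1 yz.2.
Proof.
have [I1 E1] := integrable_coupling_fst (rintegrable_sqnorm rho2).
have [I2 E2] := integrable_coupling_snd (rintegrable_sqnorm q2).
have I1' : rintegrable g (fun yz => sqnorm yz.1) by [].
have I2' : rintegrable g (fun yz => sqnorm yz.2) by [].
have Is : rintegrable g (fun yz => 2^-1 * (sqnorm yz.1 + sqnorm yz.2)).
  by apply: rintegrableZ; exact: rintegrableD.
have Ic : rintegrable g (fun yz => inner yz.1 yz.2).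
  apply: rintegrable_le Is _; last by move=> yz; exact: inner_le_sqnorm.
  by apply: measurable_inner; [exact: measurable_fst|exact: measurable_snd].
split => //.
have -> : \int[rho]_y sqnorm y + \int[q]_z sqnorm z = \int[g]_yz (sqnorm yz.1 + sqnorm yz.2).
  by rewrite RintegralD// /Rintegral E1 E2.
rewrite -RintegralZl//; last exact: rintegrableD.
rewrite -[X in _ <= X]opprK lerN2 -[X in X <= _]mulN1r -RintegralZl//.
apply: le_Rintegral => //; first exact: rintegrableZ.
by move=> yz _; rewrite mulN1r (le_trans (ler_norm _))// normrN inner_le_sqnorm.
Qed.

End Couplings.

Lemma prod_coupling {R : realType} {d : nat} (rho q : probability (Rd R d) R) :
  coupling rho q (prod_prob rho q).
Proof.
split => B mB; [rewrite -(prod_prob_fst rho q mB)|rewrite -(prod_prob_snd rho q mB)];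
by congr (prod_prob _ _ _); apply/seteqP; split => [x []|x].
Qed.

Section WeakDualityPointwise.
Context {R : realType} {d : nat}.
Notation V := 'rV[R]_d.
Variables (rho q : probability (Rd R d) R).
Hypotheses (rho2 : finite_second_moment rho) (q2 : finite_second_moment q).
Variable x : V.
Hypothesis mean_rho : forall i, (\int[rho]_y ((y : V) ord0 i)%:E)%E = (x ord0 i)%:E.

Lemma mean_inner (a : V) : \int[rho]_y inner y a = inner x a.
Proof.
rewrite /Rintegral /inner.
under eq_integral do rewrite -sumEFin.
rewrite integral_sum//; last first.
  move=> i; have := rintegrableZ (a ord0 i) (rintegrable_coord rho2 i).
  by apply: eq_integrable => // y _; rewrite /= mulrC.
rewrite -[RHS]/(fine (_)%:E) -sumEFin; congr fine; apply: eq_bigr => i _.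
under eq_integral do rewrite EFinM.
by rewrite integralZr ?mean_rho//; exact: rintegrable_coord.
Qed.

Variable psi : V -> \bar R.
Hypotheses (psiN : forall y, psi y != -oo%E) (Ipsi : rho.-integrable (setT : set (Rd R d)) psi).

Lemma psi_fin_witness : exists y r, psi y = r%:E.
Proof.
have [X [_ _ [y Xy] H]] := ae_setP (integrable_ae measurableT Ipsi).
exists y, (fine (psi y)); rewrite fineK//; exact: H.
Qed.

Lemma conj_gtNy y0 : conj psi y0 != -oo%E.
Proof.
have [y [r yr]] := psi_fin_witness.
rewrite -ltNye; apply: lt_le_trans (_ : (inner y0 y)%:E - psi y <= _)%E.
  by rewrite yr -EFinB ltNyr.
by apply: ereal_sup_ubound; exists y.
Qed.

Lemma fenchel_young y z : ((inner z y)%:E <= psi y + conj psi z)%E.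
Proof.
have H : ((inner z y)%:E - psi y <= conj psi z)%E by apply: ereal_sup_ubound; exists y.
have := psiN y; have := conj_gtNy z; move: H.
case: (psi y) => [r| |]//; last by move=> _ cz _; rewrite addye// leey.
by move=> H _ _; rewrite -leeBlDl.
Qed.

Lemma measurable_conj : measurable_fun setT (conj psi : Rd R d -> \bar R).
Proof. exact: (measurable_sup_affine setT id psi). Qed.

(** The Fenchel-Young inequality for [y] and [y0 + z] is integrated against the coupling. The term
    [<y, y0>] has expectation [<x, y0>] because [rho] has mean [x], and the supremum over [y0] forms
    the outer conjugate. *)
Lemma coupling_cost_le (g : probability (Rd R d * Rd R d)%type R) : coupling rho q g ->
  (conj (Defs.conv (conj psi) q) x <= \int[rho]_y psi y - (\int[g]_yz inner yz.1 yz.2)%:E)%E.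
Proof.
move=> cg; have [Ic _] := rintegrable_coupling_cost rho2 q2 cg.
have fp : (\int[rho]_y psi y)%E \is a fin_num by exact: integrable_fin_num.
apply: ge_ereal_sup => _ [y0 _ <-].
set F := Defs.conv (conj psi) q y0.
have mcz : measurable_fun setT (fun z : Rd R d => conj psi (y0 + (z : V))).
  apply: (measurableT_comp measurable_conj).
  by apply: measurable_RdD; [exact: measurable_cst|exact: measurable_id].
have FN : F != -oo%E.
  have [y1 [r yr]] := psi_fin_witness.
  have Ia : rintegrable q (fun z : Rd R d => inner z y1 + (inner y0 y1 - r)).
    by apply: rintegrableD; [exact: rintegrable_inner_l|exact: rintegrable_cst].
  rewrite -ltNye; apply: lt_le_trans (ltNyr (\int[q]_z (inner z y1 + (inner y0 y1 - r)))) _.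
  rewrite -rintegralE//; apply: integral_mono => z.
  apply: (@le_trans _ _ ((inner (y0 + (z : V)) y1)%:E - psi y1)%E); last first.
    by apply: ereal_sup_ubound; exists y1.
  by rewrite yr -EFinB lee_fin innerDl; lra.
have [Fy|Fy] := eqVneq F +oo%E; first by rewrite Fy addeNy leNye.
have Ff : F \is a fin_num by rewrite fin_numE FN Fy.
have IF : q.-integrable setT (fun z : Rd R d => conj psi (y0 + (z : V))).
  exact: fin_num_integrable.
have [I1 E1] := integrable_coupling_fst cg Ipsi.
have [I2 E2] := integrable_coupling_snd cg IF.
have Iy := rintegrable_inner_l rho2 y0.
have [I3 E3] := integrable_coupling_fst cg Iy.
have : (\int[g]_yz ((inner yz.1 yz.2)%:E + (inner yz.1 y0)%:E) <=
        \int[g]_yz (psi yz.1 + conj psi (y0 + (yz.2 : V))%R))%E.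
  apply: integral_mono => yz; apply: le_trans (fenchel_young _ _).
  by rewrite -EFinD lee_fin innerDl (innerC y0) (innerC yz.2) addrC.
rewrite integralD// integralD// E1 E2 E3 -/F rintegralE// [X in (_ + X <= _)%E]rintegralE// mean_inner.
have [s Es] : exists s, (\int[rho]_y psi y)%E = s%:E by exists (fine (\int[rho]_y psi y)%E); rewrite fineK.
have [t Et] : exists t, F = t%:E by exists (fine F); rewrite fineK.
rewrite -/(Defs.conv (conj psi) q y0) -/F Es Et -!EFinB -!EFinD !lee_fin; lra.
Qed.

End WeakDualityPointwise.

Section WeakDuality.
Context {R : realType} {d : nat}.
Notation V := 'rV[R]_d.
Variables (mu nu q : probability (Rd R d) R).
Hypotheses (nu2 : finite_second_moment nu) (q2 : finite_second_moment q).
Variables (pi : probability (Rd R d * Rd R d)%type R) (k : Rd R d -> probability (Rd R d) R).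
Hypothesis MTk : MT_with mu nu pi k.

Lemma MT_measurable B : measurable B -> measurable_fun setT (fun x => k x B).
Proof. by case: MTk => _ [[mk _] _]; exact: mk. Qed.

Lemma MT_mixture B : measurable B -> nu B = (\int[mu]_x k x B)%E.
Proof. by case: MTk => -[_ c2] [[_ dis] _] mB; rewrite -c2// dis. Qed.

Lemma MT_second_moment : {ae mu, forall x, finite_second_moment (k x)}.
Proof.
apply: filterS (ae_integrable_mixture MT_measurable MT_mixture (rintegrable_sqnorm nu2)).
move=> x /integrableP[_]; apply: le_lt_trans; apply: integral_mono => y.
by rewrite /= lee_fin ler_norm.
Qed.

Lemma primal_le_dual psi : dual_admissible nu psi ->
  (primal_obj mu q k <= \int[nu]_y psi y - \int[mu]_x conj (Defs.conv (conj psi) q) x)%E.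
Proof.
move=> [[psiN _] Ipsi].
set eta := conj (Defs.conv (conj psi) q).
have meta : measurable_fun setT (eta : Rd R d -> \bar R).
  exact: (measurable_sup_affine setT id (Defs.conv (conj psi) q)).
have [IS ES] := integrable_integral_mixture MT_measurable MT_mixture Ipsi.
have [IM EM] := integrable_integral_mixture MT_measurable MT_mixture (rintegrable_sqnorm nu2).
have aeI := ae_integrable_mixture MT_measurable MT_mixture Ipsi.
have [_ [_ mart]] := MTk.
(* One null set of [x] serves all couplings [g], as the supremum in [MCov] requires. *)
have ae1 : {ae mu, forall x : Rd R d, forall g, coupling (k x) q g ->
    (eta x <= \int[k x]_y psi y - (\int[g]_yz inner yz.1 yz.2)%:E)%E /\
    (\int[g]_yz (inner yz.1 yz.2)%:E)%E = (\int[g]_yz inner yz.1 yz.2)%:E}.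
  apply: filterS3 aeI mart MT_second_moment => x Ix mx m2 g cg; split.
    exact: (coupling_cost_le m2 q2 mx psiN Ix cg).
  by apply: rintegralE; exact: (rintegrable_coupling_cost m2 q2 cg).1.
have ae2 : {ae mu, forall x : Rd R d, (MCov (k x) q <= \int[k x]_y psi y - eta x)%E}.
  apply: filterS2 aeI ae1 => x Ix H; apply: ge_ereal_sup => _ [g cg <-].
  have [H1 ->] := H g cg; move: H1; have := integrable_fin_num measurableT Ix.
  case: (\int[k x]_y psi y)%E => [s| |]//= _; case: (eta x) => [t| |]//=; last by move=> _; exact: leey.
  by rewrite -!EFinB !lee_fin; lra.
(* An integrable majorant of [eta], from [ae1] for the product coupling and the moment bound on its
   cost. It keeps the integral of [eta] away from [+oo]. *)
pose h x := (\int[k x]_y psi y + (2^-1)%:E * (\int[k x]_y (sqnorm y)%:E + (\int[q]_z sqnorm z)%:E))%E.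
have Ih : mu.-integrable setT h.
  apply: integrableD => //; apply: integrableZl => //; apply: integrableD => //.
  exact: (rintegrable_cst mu (\int[q]_z sqnorm z)).
have ae3 : {ae mu, forall x : Rd R d, (eta x <= h x)%E}.
  apply: filterS3 aeI ae1 MT_second_moment => x Ix H m2.
  have [H1 _] := H _ (prod_coupling (k x) q); apply: (le_trans H1).
  rewrite /h; apply: leeD2l; rewrite rintegralE; last exact: rintegrable_sqnorm.
  rewrite -EFinD -EFinM -EFinN lee_fin lerNl.
  exact: (rintegrable_coupling_cost m2 q2 (prod_coupling (k x) q)).2.
have fS : (\int[nu]_y psi y)%E \is a fin_num by exact: integrable_fin_num.
have le1 : (primal_obj mu q k <= \int[mu]_x (\int[k x]_y psi y - eta x))%E.
  apply: ae_le_integral_r => //; apply: emeasurable_funB => //.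
  by have /measurable_int := IS.
apply: (le_trans le1).
have [eN|eN] := eqVneq (\int[mu]_x eta x)%E -oo%E.
  by rewrite eN /= addey ?leey//; move: fS; rewrite fin_numE => /andP[].
have fe : (\int[mu]_x eta x)%E \is a fin_num.
  rewrite fin_numE eN /= -ltey; apply: (@le_lt_trans _ _ (\int[mu]_x h x)%E).
    by apply: ae_le_integral_r => //; have /measurable_int := Ih.
  by rewrite ltey_eq integrable_fin_num.
have Ie : mu.-integrable setT (eta : Rd R d -> \bar R) by exact: fin_num_integrable.
by rewrite integralB// ES.
Qed.

End WeakDuality.

Lemma Pq_le_Dq {R : realType} {d : nat} (mu nu q : probability (Rd R d) R) :
  finite_second_moment nu -> finite_second_moment q -> (Pq mu nu q <= Dq mu nu q)%E.
Proof.
move=> nu2 q2; apply: ge_ereal_sup => _ [k [pi MTk] <-].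
apply: le_ereal_inf_tmp => _ [psi adm <-].
exact: (primal_le_dual nu2 q2 MTk adm).
Qed.

(** * The martingale transport of a graph *)

Section PushProbability.
Context {d1 d2} {T1 : measurableType d1} {T2 : measurableType d2} {R : realType}.

Definition push (m : probability T1 R) (f : T1 -> T2) (mf : measurable_fun setT f) :
    probability T2 R :=
  distribution m (HB.pack f (isMeasurableFun.Build _ _ _ _ _ mf) : {mfun T1 >-> T2}).

Lemma pushE m f (mf : measurable_fun setT f) B : push m mf B = m (f @^-1` B).
Proof. by []. Qed.

End PushProbability.

Section GraphKernel.
Context {R : realType} {d : nat}.
Notation V := 'rV[R]_d.
Notation W := (Rd R d * Rd R d)%type.
Variables (mu nu q : probability (Rd R d) R).
Hypotheses (mu2 : finite_second_moment mu) (nu2 : finite_second_moment nu)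
  (q2 : finite_second_moment q).
Notation P := (prod_prob mu q).
Variables (T : W -> Rd R d) (mT : measurable_fun setT T).

Lemma measurable_section (x : Rd R d) : measurable_fun setT (fun z => T (x, z)).
Proof. by apply: (measurableT_comp mT); exact: pair1_measurable. Qed.

Definition graph_kernel (x : Rd R d) : probability (Rd R d) R := push q (measurable_section x).

Lemma graph_kernelE x B : graph_kernel x B = q [set z | B (T (x, z))].
Proof. by []. Qed.

Lemma measurable_graph : measurable_fun setT (fun w : W => (w.1, T w)).
Proof. by apply: measurable_fun_pair => //; exact: measurable_fst. Qed.

Definition graph_plan : probability (Rd R d * Rd R d)%type R := push P measurable_graph.

Lemma graph_plan_rect A B : graph_plan (A `*` B) = P (fst @^-1` A `&` T @^-1` B).
Proof. by []. Qed.

Variables (L : (W * V -> R) -> R) (mL : martingale_plan mu nu q L) (gT : on_graph L T).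
Let pL : plan P nu L := mL.1.

Lemma graph_plan_coupling : coupling mu nu graph_plan.
Proof.
split => B mB; rewrite graph_plan_rect preimage_setT ?setIT ?setTI.
  exact: prod_prob_fst.
exact: (on_graph_snd_law pL mT gT mB).
Qed.

Lemma graph_kernel_measurable B : measurable B -> measurable_fun setT (fun x => graph_kernel x B).
Proof.
move=> mB.
have mTB : measurable (T @^-1` B) by rewrite -[X in measurable X]setTI; exact: mT.
apply: eq_measurable_fun (measurable_fun_xsection q mTB) => x _.
rewrite graph_kernelE; congr (q _); apply/seteqP.
by split => z; rewrite /xsection /= inE.
Qed.

Lemma graph_plan_disintegration : disintegration mu graph_plan graph_kernel.
Proof.
split; first exact: graph_kernel_measurable.
move=> A B mA mB; rewrite graph_plan_rect [RHS]integral_mkcond.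
apply: eq_integral => x _; rewrite patchE graph_kernelE /=.
case: ifPn => xA.
  congr (q _); apply/seteqP; split => z; rewrite /xsection /= inE; first by case.
  by move=> TB; split => //; exact: set_mem.
rewrite [X in q X](_ : _ = set0) ?measure0//; apply/seteqP; split => // z.
by rewrite /xsection /= inE => -[xA' _]; move: xA; rewrite notin_setE.
Qed.

Lemma graph_coord_mul i (g : W -> R) : measurable_fun setT g ->
  rintegrable P (fun w => g w ^+ 2) ->
  rintegrable P (fun w => (T w : V) ord0 i * g w) /\
  L (fun s => s.2 ord0 i * g s.1) = \int[P]_w ((T w : V) ord0 i * g w).
Proof. by move=> mg Ig; apply: (on_graph_mul pL mT gT) => //; exact: rintegrable_coord_sqr. Qed.

Lemma rintegrable_T i : rintegrable P (fun w => (T w : V) ord0 i).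
Proof.
have mg : measurable_fun setT (cst 1 : W -> R) by exact: measurable_cst.
have [|+ _] := graph_coord_mul i mg.
  apply: (@rintegrable_bounded _ _ _ _ _ 1); first by apply: measurable_funX.
  by move=> x; rewrite expr1n normr1.
by apply: eq_integrable => // w _; rewrite /cst /= mulr1.
Qed.

(** The bounded field equal to the [i]-th unit vector times the indicator of [A] turns the drift
    condition on [L] into equality of the integrals over [A] of [x_i] and of the mean of
    [T_i (x, Z)]. As [A] is an arbitrary Borel set, the two agree almost everywhere. *)
Lemma graph_kernel_martingale : martingale_kernel mu graph_kernel.
Proof.
have H (i : 'I_d) : {ae mu, forall x : Rd R d,
     (\int[graph_kernel x]_y ((y : V) ord0 i)%:E)%E = ((x : V) ord0 i)%:E}.
  have [aeI IPhi _] := rintegral_fubini (rintegrable_T i).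
  set Phi := (fun x => _) in IPhi.
  have aeE : ae_eq mu setT (EFin \o Phi) (fun x : Rd R d => ((x : V) ord0 i)%:E).
    apply: integral_ae_eq => //.
      by apply/measurable_EFinP; exact: measurable_coord.
    move=> A _ mA.
    pose g (w : W) : R := \1_A w.1.
    have mg : measurable_fun setT g.
      by apply: measurableT_comp measurable_fst; exact: measurable_indic.
    have g1 w : `|g w| <= 1.
      by rewrite /g indicE; case: (_ \in _); rewrite ?normr1// normr0.
    have Ig2 : rintegrable P (fun w => g w ^+ 2).
      apply: (@rintegrable_bounded _ _ _ _ _ 1); first exact: measurable_funX.
      by move=> w; rewrite normrX exprn_ile1.
    have [ITg LT] := graph_coord_mul i mg Ig2.
    have Ix : rintegrable P (fun w : W => (w.1 : V) ord0 i * g w).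
      have Ix0 := integrable_image measurable_fst (prod_prob_fst mu q) (rintegrable_coord mu2 i).
      apply: (@rintegrable_le _ _ _ _ _ (fun w : W => `|(w.1 : V) ord0 i|)).
      - apply: measurable_funM => //; apply: measurable_coord_comp; exact: measurable_fst.
      - exact: (rintegrable_norm Ix0).
      - by move=> w; rewrite normrM -[leRHS]mulr1 ler_wpM2l.
    pose b (x : Rd R d) : Rd R d := \row_j (if j == i then \1_A x else 0).
    have bb : bounded_field b.
      split.
        apply: measurable_fun_Rd => j; under eq_fun do rewrite mxE.
        by case: (j == i); [exact: measurable_indic|exact: measurable_cst].
      exists 1 => x j; rewrite mxE; case: (j == i); last by rewrite normr0.
      by rewrite indicE; case: (_ \in _); rewrite ?normr1// normr0.
    have dg : plan_dom P nu (fun s => s.2 ord0 i * g s.1).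
      exists (fun w => g w ^+ 2), (fun y => (y : V) ord0 i ^+ 2); split => //.
        exact: rintegrable_coord_sqr.
      move=> s; rewrite ler_norml.
      have := sqr_ge0 (g s.1 - s.2 ord0 i); have := sqr_ge0 (g s.1 + s.2 ord0 i).
      by move=> *; apply/andP; split; nra.
    have E0 : \int[P]_w ((w.1 : V) ord0 i * g w) = \int[P]_w ((T w : V) ord0 i * g w).
      apply/eqP; rewrite -subr_eq0 -LT -(plan_fst pL Ix) -(planB pL (plan_dom_fst nu Ix) dg).
      rewrite -(mL.2 _ bb); apply/eqP; congr L; apply/funext => s.
      rewrite /inner (bigD1 i)//= big1 ?addr0 => [|j /negPf ji]; last by rewrite /b [X in _ * X]mxE ji mulr0.
      by rewrite /b !mxE eqxx /g mulrBl.
    have [_ IP1 P1] := rintegral_fubini ITg.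
    have [_ IP2 P2] := rintegral_fubini Ix.
    move: E0; rewrite P1 P2 => E0.
    have F1 x : \int[q]_z ((T (x, z) : V) ord0 i * g (x, z)) = Phi x * \1_A x.
      rewrite /g /= indicE; case: (_ \in _); rewrite /= ?mulr1 ?mulr0.
        by apply: eq_Rintegral => z _; rewrite mulr1.
      rewrite (_ : (fun z => _) = cst 0); first by rewrite Rintegral_cstP.
      by apply/funext => z; rewrite mulr0.
    have F2 (x : Rd R d) : \int[q]_z ((x : V) ord0 i * g (x, z)) = (x : V) ord0 i * \1_A x.
      by rewrite /g /= Rintegral_cstP.
    rewrite [LHS]integral_mkcond [RHS]integral_mkcond.
    have eqR (f : Rd R d -> R) (h : Rd R d -> R) : (forall x, h x = f x * \1_A x) ->
       rintegrable mu h -> (\int[mu]_x ((EFin \o f) \_ A) x)%E = (\int[mu]_x h x)%:E.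
      move=> hf Ih; rewrite -rintegralE//; apply: eq_integral => x _.
      by rewrite hf patchE indicE; case: (_ \in _); rewrite /= ?mulr1 ?mulr0.
    rewrite (eqR _ _ F1 IP1) (eqR (fun x : Rd R d => (x : V) ord0 i) _ F2 IP2).
    by rewrite E0.
  apply: filterS2 aeI aeE => x Ix /(_ Logic.I) /= <-.
  rewrite /graph_kernel (_ : Phi x = \int[q]_z (T (x, z) : V) ord0 i)//.
  rewrite -rintegralE//.
  apply/esym/(integral_image (measurable_section x)) => //.
  by apply/measurable_EFinP; exact: measurable_coord.
exact: filter_forall.
Qed.

Lemma graph_MT : MT_with mu nu graph_plan graph_kernel.
Proof.
split; [exact: graph_plan_coupling|split; [exact: graph_plan_disintegration|]].
exact: graph_kernel_martingale.
Qed.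

Lemma graph_cost : rintegrable P (fun w => inner (T w) w.2) /\
  L (@cost R d) = \int[P]_w inner (T w) w.2.
Proof.
have mg i : measurable_fun setT (fun w : W => (w.2 : V) ord0 i).
  by apply: measurable_coord_comp; exact: measurable_snd.
have Ig i : rintegrable P (fun w : W => (w.2 : V) ord0 i ^+ 2).
  exact: (integrable_image measurable_snd (prod_prob_snd mu q) (rintegrable_coord_sqr q2 i)).
have dg i : plan_dom P nu (fun s : W * V => s.2 ord0 i * (s.1.2 : V) ord0 i).
  exists (fun w : W => (w.2 : V) ord0 i ^+ 2), (fun y => (y : V) ord0 i ^+ 2); split => //.
    exact: rintegrable_coord_sqr.
  move=> s; rewrite ler_norml.
  have := sqr_ge0 ((s.1.2 : V) ord0 i - s.2 ord0 i); have := sqr_ge0 ((s.1.2 : V) ord0 i + s.2 ord0 i).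
  by move=> *; apply/andP; split; nra.
suff [_ [I E]] : plan_dom P nu (fun s : W * V => \sum_(i <- index_enum 'I_d) s.2 ord0 i * (s.1.2 : V) ord0 i) /\
    rintegrable P (fun w => \sum_(i <- index_enum 'I_d) (T w : V) ord0 i * (w.2 : V) ord0 i) /\
    L (fun s => \sum_(i <- index_enum 'I_d) s.2 ord0 i * (s.1.2 : V) ord0 i) =
    \int[P]_w \sum_(i <- index_enum 'I_d) (T w : V) ord0 i * (w.2 : V) ord0 i by [].
elim: (index_enum 'I_d) => [|i r [dr [Ir Er]]].
  have f0 (S : Type) (f : S -> 'I_d -> R) : (fun s => \sum_(i <- [::]) f s i) = fun=> 0.
    by apply/funext => s; rewrite big_nil.
  rewrite !f0; split; first by apply: (@plan_dom_bounded _ _ _ _ _ _ _ 0) => s; rewrite normr0.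
  split; first exact: rintegrable_cst.
  by rewrite -(plan_fst pL (rintegrable_cst P 0)).
have fD (S : Type) (f : S -> 'I_d -> R) : (fun s => \sum_(i <- i :: r) f s i) =
    fun s => f s i + \sum_(i <- r) f s i.
  by apply/funext => s; rewrite big_cons.
have [Ii Ei] := graph_coord_mul i (mg i) (Ig i).
rewrite !fD; split; first exact: plan_domD.
split; first exact: rintegrableD.
by rewrite (planD pL)// Ei Er RintegralD.
Qed.

(** The law of [(T (x, Z), Z)] couples [graph_kernel x] with [q]. *)
Lemma graph_kernel_MCov x :
  ((\int[q]_z (inner (T (x, z)) z)%:E) <= MCov (graph_kernel x) q)%E.
Proof.
have mp : measurable_fun setT (fun z => (T (x, z), z)).
  by apply: measurable_fun_pair => //; exact: measurable_section.
apply: ereal_sup_ubound; exists (push q mp).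
  by split => B mB; rewrite pushE; congr (q _); apply/seteqP; split => [z []|z].
apply/esym/(integral_image mp (n := push q mp)) => //.
apply/measurable_EFinP.
by apply: measurable_inner; [exact: measurable_fst|exact: measurable_snd].
Qed.

Lemma graph_primal : ((L (@cost R d))%:E <= primal_obj mu q graph_kernel)%E.
Proof.
have [I ->] := graph_cost.
have I' : (mu \x q)%E.-integrable setT (EFin \o (fun w : W => inner (T w) w.2)) by exact: I.
rewrite -rintegralE//.
rewrite -[X in (X <= _)%E](integral12_prod_meas1 I').
by apply: integral_mono => x; exact: graph_kernel_MCov.
Qed.

End GraphKernel.

(** * Uniqueness *)

Lemma prod_measure_eq {d1 d2} {T1 : measurableType d1} {T2 : measurableType d2} {R : realType}
  (m1 m2 : probability (T1 * T2)%type R) :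
  (forall A B, measurable A -> measurable B -> m1 (A `*` B) = m2 (A `*` B)) ->
  forall X, measurable X -> m1 X = m2 X.
Proof.
move=> m12 X mX.
pose C : set (set (T1 * T2)) := [set A `*` B | A in measurable & B in measurable].
apply: (@g_sigma_algebra_measure_unique _ _ _ C _ (fun=> setT)) => //.
- by move=> _ [A mA [B mB <-]]; exact: measurableX.
- by move=> _; exists setT => //; exists setT => //; rewrite setXTT.
- by rewrite bigcup_const//; exists 0%N.
- move=> _ _ [A mA [B mB <-]] [A' mA' [B' mB' <-]]; rewrite -setXI.
  by exists (A `&` A'); [exact: measurableI|exists (B `&` B') => //; exact: measurableI].
- by move=> _ [A mA [B mB <-]]; exact: m12.
- by move=> _; rewrite [X in (X < _)%E](@probability_setT _ _ _ m1) ltry.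
- by rewrite -measurable_prod_measurableType.
Qed.

Section KernelProgram.
Context {R : realType} {d : nat}.
Notation V := 'rV[R]_d.
Notation W := (Rd R d * Rd R d)%type.
Variables (mu nu q : probability (Rd R d) R).
Hypotheses (mu2 : finite_second_moment mu) (nu2 : finite_second_moment nu)
  (q2 : finite_second_moment q).
Variables (pi : probability (Rd R d * Rd R d)%type R) (k : Rd R d -> probability (Rd R d) R).
Hypothesis MTk : MT_with mu nu pi k.
Notation P := (prod_prob mu q).

(* [X] stands for the conditional expectation of [chi (X, Y)] given X; it is a
   separate datum, required to be mu-integrable, because [x |-> \int chi (x, y) k x (dy)]
   is only controlled almost everywhere. *)
Definition kernel_program : set ((W * V -> R) * R) := [set p | exists phi (chi : Rd R d -> Rd R d -> R) X,
  [/\ rintegrable P phi, rintegrable mu X,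
      {ae mu, forall x, rintegrable (k x) (chi x) /\ \int[k x]_y chi x y = X x}
    & p = (fun s => phi s.1 + chi s.1.1 s.2, \int[P]_w phi w + \int[mu]_x X x)]].

Lemma kernel_program_linear : linear_graph kernel_program.
Proof.
move=> t _ _ _ _ [p1 [c1 [X1 [I1 J1 A1 [-> ->]]]]] [p2 [c2 [X2 [I2 J2 A2 [-> ->]]]]].
exists (fun w => t * p1 w + p2 w), (fun x y => t * c1 x y + c2 x y), (fun x => t * X1 x + X2 x); split.
- by apply: rintegrableD => //; exact: rintegrableZ.
- by apply: rintegrableD => //; exact: rintegrableZ.
- apply: filterS2 A1 A2 => x [Ic1 E1] [Ic2 E2]; split.
    by apply: rintegrableD => //; exact: rintegrableZ.
  by rewrite Rintegral_lin// E1 E2.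
- congr pair; first by apply/funext => s; ring.
  by rewrite !Rintegral_lin//; ring.
Qed.

Lemma kernel_program_mem phi chi X : rintegrable P phi -> rintegrable mu X ->
  {ae mu, forall x, rintegrable (k x) (chi x) /\ \int[k x]_y chi x y = X x} ->
  kernel_program (fun s => phi s.1 + chi s.1.1 s.2, \int[P]_w phi w + \int[mu]_x X x).
Proof. by move=> Ip IX aeX; exists phi, chi, X. Qed.

Lemma kernel_program0 : kernel_program (fun=> 0, 0).
Proof.
have := @kernel_program_mem (fun=> 0) (fun _ _ => 0) (fun=> 0) (rintegrable_cst P 0) (rintegrable_cst mu 0).
rewrite !Rintegral_cstP !addr0; apply; apply: aeW => x; split; first exact: rintegrable_cst.
by rewrite Rintegral_cstP.
Qed.

(** For almost every [x], nonnegativity is integrated over [k x] and [q] independently. *)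
Lemma kernel_program_positive : positive_graph kernel_program.
Proof.
move=> _ _ [phi [chi [X [Ip IX aeX [-> ->]]]]] pos.
have [aeI IPhi ->] := rintegral_fubini Ip.
set Phi := (fun x => _) in IPhi *.
rewrite -RintegralD// /Rintegral; apply: fine_ge0.
rewrite -[X in (X <= _)%E](integral0 mu setT).
apply: ae_le_integral_r.
  by apply/measurable_EFinP; apply: rintegrable_measurable; exact: rintegrableD IPhi IX.
apply: filterS2 aeI aeX => x Iq [Ik Xx]; rewrite lee_fin -Xx.
have -> : Phi x + \int[k x]_y chi x y = \int[q]_z (phi (x, z) + \int[k x]_y chi x y).
  by rewrite RintegralD ?Rintegral_cstP//; exact: rintegrable_cst.
apply: Rintegral_ge0 => z _.
have -> : phi (x, z) + \int[k x]_y chi x y = \int[k x]_y (phi (x, z) + chi x y).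
  by rewrite RintegralD ?Rintegral_cstP//; exact: rintegrable_cst.
by apply: Rintegral_ge0 => y _; exact: (pos ((x, z), y)).
Qed.

Lemma kernel_mixture_mem (chi : Rd R d -> R) : rintegrable nu chi ->
  exists X, [/\ rintegrable mu X, {ae mu, forall x, rintegrable (k x) chi /\ \int[k x]_y chi y = X x}
   & \int[mu]_x X x = \int[nu]_y chi y].
Proof.
move=> Ic.
have [IS ES] := integrable_integral_mixture (MT_measurable MTk) (MT_mixture MTk) Ic.
have aeI := ae_integrable_mixture (MT_measurable MTk) (MT_mixture MTk) Ic.
have /measurable_int mS := IS.
have mX : measurable_fun setT (fun x => \int[k x]_y chi y).
  exact: (measurableT_comp (fine_measurable measurableT) mS).
have aeE : ae_eq mu setT (EFin \o (fun x => \int[k x]_y chi y)) (fun x => (\int[k x]_y (chi y)%:E)%E).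
  by apply: filterS aeI => x Ix _; rewrite /= rintegralE.
exists (fun x => \int[k x]_y chi y); split.
- apply: le_integrable IS => //; first exact/measurable_EFinP.
  move=> x _; rewrite /= /Rintegral.
  by case: (\int[k x]_y _)%E => [r||]//=; rewrite normr0 leey.
- by apply: filterS aeI => x.
- rewrite {1}/Rintegral.
  have -> : (\int[mu]_x (\int[k x]_y chi y)%:E)%E = (\int[mu]_x \int[k x]_y (chi y)%:E)%E.
    by apply: ae_eq_integral => //; exact/measurable_EFinP.
  by rewrite [X in fine X = _]ES.
Qed.

Lemma kernel_program_marginals phi chi : rintegrable P phi -> rintegrable nu chi ->
  kernel_program (fun s => phi s.1 + chi s.2, \int[P]_w phi w + \int[nu]_y chi y).
Proof.
move=> Ip Ic; have [X [IX aeX <-]] := kernel_mixture_mem Ic.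
exact: (kernel_program_mem Ip IX aeX).
Qed.

Lemma kernel_program_dominated h : plan_dom P nu h -> dominated kernel_program h.
Proof.
move=> [phi [chi [Ip Ic hle]]]; exists (fun s => phi s.1 + chi s.2), (\int[P]_w phi w + \int[nu]_y chi y).
by split => //; exact: kernel_program_marginals.
Qed.

Lemma kernel_program_drift b : bounded_field b ->
  kernel_program (fun s => inner ((s.1.1 : V) - s.2) (b s.1.1), 0).
Proof.
move=> bb.
have [_ [_ mart]] := MTk.
have := @kernel_program_mem (fun=> 0) (fun (x y : V) => inner (x - y) (b x)) (fun=> 0)
  (rintegrable_cst P 0) (rintegrable_cst mu 0).
rewrite !Rintegral_cstP addr0.
rewrite (_ : (fun s : W * V => 0 + _) = fun s => inner ((s.1.1 : V) - s.2) (b s.1.1)); last first.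
  by apply/funext => s; rewrite add0r.
apply; apply: filterS2 mart (MT_second_moment nu2 MTk) => x mx m2.
have Iy := rintegrable_inner_l m2 (b x).
have Iy' := rintegrableZ (-1) Iy.
have E : (fun y : V => inner ((x : V) - y) (b x)) = fun y => inner x (b x) + -1 * inner y (b x).
  by apply/funext => y; rewrite innerBl mulN1r.
rewrite E; split; first by apply: rintegrableD => //; exact: rintegrable_cst.
rewrite RintegralD//; last exact: rintegrable_cst.
by rewrite Rintegral_cstP RintegralZl// (mean_inner m2 mx) mulN1r subrr.
Qed.

(** Puts the masses of rectangles under [pi] into the program, so that every extension remembers
    [pi]. *)
Lemma kernel_program_rect (A B : set (Rd R d)) : measurable A -> measurable B ->
  kernel_program (\1_[set s : W * V | (fst @^-1` A) s.1 /\ B s.2], fine (pi (A `*` B))).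
Proof.
move=> mA mB; have [_ [[mk dis] _]] := MTk.
pose X x : R := \1_A x * fine (k x B).
have mX : measurable_fun setT X.
  apply: measurable_funM; first exact: measurable_indic.
  exact: (measurableT_comp (fine_measurable measurableT) (mk _ mB)).
have IX : rintegrable mu X.
  apply: (@rintegrable_bounded _ _ _ _ _ 1) => // x; rewrite /X indicE normrM.
  rewrite mulr_ile1//; first by case: (_ \in _); rewrite ?normr1// normr0.
  rewrite ger0_norm ?fine_ge0// -lee_fin fineK ?fin_num_measure//.
  exact: probability_le1.
have := @kernel_program_mem (fun=> 0) (fun x y => \1_A x * \1_B y) X (rintegrable_cst P 0) IX.
rewrite Rintegral_cstP add0r.
rewrite (_ : (fun s : W * V => _) = \1_[set s : W * V | (fst @^-1` A) s.1 /\ B s.2]); last first.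
  apply/funext => s; rewrite add0r !indicE -natrM mulnb; congr (nat_of_bool _)%:R.
  by apply/andP/idP; rewrite !inE.
rewrite (_ : \int[mu]_x X x = fine (pi (A `*` B))); last first.
  rewrite dis// /Rintegral; congr fine; rewrite [RHS]integral_mkcond.
  apply: eq_integral => x _; rewrite patchE /X indicE.
  by case: (_ \in _); rewrite ?mul0r// mul1r fineK// fin_num_measure.
apply; apply: aeW => x; split.
  by apply: rintegrableZ; exact: rintegrable_indic.
by rewrite RintegralZl ?Rintegral_indic//; exact: rintegrable_indic.
Qed.

(** For almost every [x], the pointwise bound is integrated against each coupling of [k x] and [q],
    so it passes to [MCov]. *)
Lemma kernel_program_primal_le phi chi X : rintegrable P phi -> rintegrable mu X ->
  {ae mu, forall x, rintegrable (k x) (chi x) /\ \int[k x]_y chi x y = X x} ->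
  (forall s : W * V, cost s <= phi s.1 + chi s.1.1 s.2) ->
  (primal_obj mu q k <= (\int[P]_w phi w + \int[mu]_x X x)%:E)%E.
Proof.
move=> Ip IX aeX cle; have [aeI IPhi ->] := rintegral_fubini Ip.
set Phi := (fun x => _) in IPhi *.
have IS := rintegrableD IPhi IX.
rewrite -RintegralD// -rintegralE//; apply: ae_le_integral_r.
  by apply/measurable_EFinP; exact: rintegrable_measurable IS.
apply: filterS2 aeI aeX => x Iq [Ik Xx]; apply: ge_ereal_sup => _ [g cg <-].
have [I1 E1] := integrable_coupling_fst cg Ik.
have [I2 E2] := integrable_coupling_snd cg Iq.
apply: (@le_trans _ _ (\int[g]_yz ((phi (x, yz.2))%:E + (chi x yz.1)%:E))%E).
  apply: integral_mono => yz; rewrite -EFinD lee_fin.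
  exact: (cle ((x, yz.2), yz.1)).
rewrite integralD// [X in (X + _ <= _)%E]E2 [X in (_ + X <= _)%E]E1.
by rewrite rintegralE// rintegralE// -EFinD lee_fin Xx.
Qed.

(** The extension takes the infimum of the upper values at the cost, and each of these dominates the
    primal value of [k]. Thus [L] plays the role of optimal couplings glued along [x]. *)
Lemma exists_kernel_plan : exists L, [/\ martingale_plan mu nu q L,
   (forall A B : set (Rd R d), measurable A -> measurable B ->
      L (\1_[set s : W * V | (fst @^-1` A) s.1 /\ B s.2]) = fine (pi (A `*` B)))
  & (primal_obj mu q k <= (L (@cost R d))%:E)%E].
Proof.
have [L [ext opt]] := riesz_extension kernel_program_linear kernel_program0 kernel_program_positive
  (kernel_program_dominated (plan_dom_cost mu nu2 q2)).
exists L; have [_ _ UL] := ext; split.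
- split; last by move=> b bb; apply: UL; exact: kernel_program_drift.
  by apply: (plan_of_extension ext); [exact: kernel_program_dominated|exact: kernel_program_marginals].
- by move=> A B mA mB; apply: UL; exact: kernel_program_rect.
- apply/lee_addgt0Pr => e e0; have [u [v [[phi [chi [X [Ip IX aeX [-> ->]]]]] cle ve]]] := opt e e0.
  by apply: (le_trans (kernel_program_primal_le Ip IX aeX cle)); rewrite -EFinD lee_fin.
Qed.

End KernelProgram.

Section Uniqueness.
Context {R : realType} {d : nat}.
Notation V := 'rV[R]_d.
Notation W := (Rd R d * Rd R d)%type.
Variables (mu nu q : probability (Rd R d) R).
Hypotheses (mu2 : finite_second_moment mu) (nu2 : finite_second_moment nu)
  (q2 : finite_second_moment q) (qs : no_mass_small_sets q).
Notation P := (prod_prob mu q).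

Lemma optimal_plan_graph (L : (W * V -> R) -> R) : optimal_plan mu nu q L ->
  exists2 T : W -> Rd R d, measurable_fun setT T & on_graph L T.
Proof.
move=> [mL opt].
have /choice[D DP] : forall n : nat, exists D : (W -> R) * (Rd R d -> R) * (Rd R d -> Rd R d),
    feasible mu nu q D.1.1 D.1.2 D.2 /\
    \int[P]_w D.1.1 w + \int[nu]_y D.1.2 y <= L (@cost R d) + (4^-1) ^+ n.
  move=> n; have [|phi [chi [b [H1 H2]]]] := opt ((4^-1) ^+ n); first by rewrite exprn_gt0.
  by exists (phi, chi, b).
pose G n (w : W) := (D n).1.1 w + inner w.1 ((D n).2 w.1).
have slE n : slack (G n) (D n).2 (D n).1.2 =
    fun s => constraint (D n).1.1 (D n).1.2 (D n).2 s - cost s.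
  apply/funext => s; rewrite /slack /constraint /cost /G innerDr innerBl.
  by rewrite (innerC s.2 s.1.2); ring.
have dc n : plan_dom P nu (constraint (D n).1.1 (D n).1.2 (D n).2).
  by have [[Ip Ic bb _] _] := DP n; exact: plan_dom_constraint.
apply: (optimal_on_graph qs mL.1 (G := G) (b := fun n => (D n).2) (chi := fun n => (D n).1.2)).
- move=> n; have [[Ip _ [mb _] _] _] := DP n.
  apply: measurable_funD; first exact: rintegrable_measurable Ip.
  apply: measurable_inner; first exact: measurable_fst.
  exact: (measurableT_comp mb measurable_fst).
- by move=> n; have [[_ _ [mb _] _] _] := DP n.
- by move=> n s; have [[_ _ _ cle] _] := DP n; rewrite slE subr_ge0.
- by move=> n; rewrite slE; apply: plan_domB => //; exact: plan_dom_cost.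
- move=> n; have [[Ip Ic bb _] le] := DP n.
  rewrite slE (planB mL.1) ?(martingale_plan_constraint mu2 nu2 mL)//; last exact: plan_dom_cost.
  by rewrite lerBlDl.
Qed.

Definition mean_plan (L L' : (W * V -> R) -> R) h := 2^-1 * (L h + L' h).

(** The cost of the mean is at least that of [L], so the triples that certify [L] certify the mean
    as well. *)
Lemma mean_plan_optimal (L L' : (W * V -> R) -> R) : optimal_plan mu nu q L ->
  martingale_plan mu nu q L' -> L (@cost R d) <= L' (@cost R d) ->
  optimal_plan mu nu q (mean_plan L L').
Proof.
move=> [[pL mL] opt] [pL' mL'] LL'; split; first split; first split.
- move=> k f g df dg; have [l1 _ _ _] := pL; have [l2 _ _ _] := pL'.
  by rewrite /mean_plan l1// l2//; ring.
- by move=> f df f0; rewrite /mean_plan mulr_ge0// addr_ge0//;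
    [exact: (plan_ge0 pL)|exact: (plan_ge0 pL')].
- by move=> phi Ip; rewrite /mean_plan (plan_fst pL)// (plan_fst pL')//; lra.
- by move=> chi Ic; rewrite /mean_plan (plan_snd pL)// (plan_snd pL')//; lra.
- by move=> b bb; rewrite /mean_plan mL// mL'// addr0 mulr0.
- move=> e e0; have [phi [chi [b [fb le]]]] := opt e e0; exists phi, chi, b; split => //.
  by apply: (le_trans le); rewrite /mean_plan; lra.
Qed.

Lemma mean_plan_null (L L' : (W * V -> R) -> R) N : plan P nu L -> plan P nu L' ->
  plan_null (mean_plan L L') N -> plan_null L N /\ plan_null L' N.
Proof.
move=> pL pL'; rewrite /plan_null /mean_plan => H.
by have := plan_indic_ge0 pL N; have := plan_indic_ge0 pL' N; split; lra.
Qed.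

(** That [T] and [T'] are far apart is an event of [w] alone. It is null under [L], hence under [P],
    hence under [L'], which has the same first marginal. *)
Lemma on_graph_change (L L' : (W * V -> R) -> R) (T T' : W -> Rd R d) :
  plan P nu L -> plan P nu L' -> measurable_fun setT T -> measurable_fun setT T' ->
  on_graph L T -> on_graph L T' -> on_graph L' T' -> on_graph L' T.
Proof.
move=> pL pL' mT mT' LT LT' L'T' e e0.
have e2 : 0 < e / 2 by rewrite divr_gt0.
pose A : set W := [set w | exists i, e / 2 < `|(T' w : V) ord0 i - (T w : V) ord0 i|].
have mA : measurable A.
  have -> : A = \bigcup_(i in [set: 'I_d])
     ((fun w => `|(T' w : V) ord0 i - (T w : V) ord0 i|) @^-1` `]e / 2, +oo[%classic).
    apply/seteqP; split => [x [i Hi]|x [i _]]; first by exists i => //=; rewrite in_itv/= andbT.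
    by rewrite /= in_itv/= andbT => ?; exists i.
  apply: fin_bigcup_measurable => [|i _]; first exact: finite_finset.
  rewrite -[X in measurable X]setTI; apply: measurableT_comp => //.
  by apply: measurable_funB; exact: measurable_coord_comp.
have e4 : 0 < e / 4 by rewrite divr_gt0.
have A0 : P A = 0%E.
  apply: (plan_null_P pL mA).
  apply: (plan_nullS pL _ (plan_nullU pL (LT _ e4) (LT' _ e4))) => s [i Hi].
  apply: contrapT => /not_orP[n1 n2].
  have h1 : `|s.2 ord0 i - (T s.1 : V) ord0 i| <= e / 4 by rewrite leNgt; apply/negP => ?; apply: n1; exists i.
  have h2 : `|s.2 ord0 i - (T' s.1 : V) ord0 i| <= e / 4 by rewrite leNgt; apply/negP => ?; apply: n2; exists i.
  move: Hi; apply/negP; rewrite -leNgt ler_norml.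
  by move: h1 h2; rewrite !ler_norml => /andP[? ?] /andP[? ?]; apply/andP; split; lra.
apply: (plan_nullS pL' _ (plan_nullU pL' (L'T' _ e2) (plan_null_fst pL' mA A0))) => s [i Hi].
apply: contrapT => /not_orP[n1 n2].
have h1 : `|s.2 ord0 i - (T' s.1 : V) ord0 i| <= e / 2 by rewrite leNgt; apply/negP => ?; apply: n1; exists i.
have h2 : `|(T' s.1 : V) ord0 i - (T s.1 : V) ord0 i| <= e / 2 by rewrite leNgt; apply/negP => ?; apply: n2; exists i.
move: Hi; apply/negP; rewrite -leNgt ler_norml.
by move: h1 h2; rewrite !ler_norml => /andP[? ?] /andP[? ?]; apply/andP; split; lra.
Qed.

Lemma optimal_unique (L : (W * V -> R) -> R) (T : W -> Rd R d) (mT : measurable_fun setT T) pi k :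
  optimal_plan mu nu q L -> on_graph L T -> MT_with mu nu pi k ->
  ((L (@cost R d))%:E <= primal_obj mu q k)%E ->
  forall A, measurable A -> pi A = graph_plan mu q mT A.
Proof.
move=> oL gT MTk Lk; have [mL _] := oL.
have [L' [mL' rect L'k]] := exists_kernel_plan nu2 q2 MTk.
have LL' : L (@cost R d) <= L' (@cost R d) by rewrite -lee_fin (le_trans Lk).
have [T' mT' gT'] := optimal_plan_graph (mean_plan_optimal oL mL' LL').
have nul e (e0 : 0 < e) := mean_plan_null mL.1 mL'.1 (gT' e e0).
have gL'T : on_graph L' T.
  apply: (on_graph_change mL.1 mL'.1 mT mT' gT) => e e0; [exact: (nul e e0).1|exact: (nul e e0).2].
apply: prod_measure_eq => A B mA mB; rewrite graph_plan_rect.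
(* The measure [C |-> pi (A x C)]: comparing it with [P] through [on_graph_law] identifies [pi] on
   rectangles. *)
pose kf : {measure set (Rd R d) -> \bar R} := pushforward (mrestr pi (measurableX mA measurableT)) snd.
pose kp := kf measurable_snd.
have kpE C : kp C = pi (A `*` C).
  rewrite /kp /= /pushforward /mrestr; congr (pi _).
  by apply/seteqP; split => [[x y] [] ? []//|[x y] []].
rewrite -kpE; apply/esym; apply: (on_graph_law mL'.1 mT gL'T) => //.
- by rewrite -[X in measurable X]setTI; exact: measurable_fst.
- by rewrite kpE ltey_eq fin_num_measure//; exact: measurableX.
- by move=> C mC; rewrite rect// kpE.
Qed.

End Uniqueness.

Unset Implicit Arguments.

Theorem theorem1p1 (R : realType) (d : nat) (mu nu q : probability (Rd R d) R) :
  finite_second_moment mu -> finite_second_moment nu -> finite_second_moment q ->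
  convex_order mu nu ->
  no_mass_small_sets q ->
  [/\ (exists pihat : probability (Rd R d * Rd R d)%type R,
         (exists k, MT_with mu nu pihat k /\ primal_obj mu q k = Pq mu nu q) /\
         (forall (pi : probability (Rd R d * Rd R d)%type R) k,
            MT_with mu nu pi k -> primal_obj mu q k = Pq mu nu q ->
            forall A, measurable A -> pi A = pihat A)),
      Pq mu nu q \is a fin_num
    & Pq mu nu q = Dq mu nu q].
Proof.
move=> mu2 nu2 q2 cvx qs.
have [L oL] := exists_optimal_plan nu2 q2 cvx; have [mL opt] := oL.
have [T mT gT] := optimal_plan_graph mu2 nu2 q2 qs oL.
have MTg := graph_MT mu2 nu2 mT mL gT.
have DL : (Dq mu nu q <= (L (@cost R d))%:E)%E.
  apply/lee_addgt0Pr => e e0; have [phi [chi [b [fb le]]]] := opt e e0.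
  by apply: (le_trans (feasible_dual_le nu2 fb)); rewrite -EFinD lee_fin.
have Lg := graph_primal nu2 q2 mT mL gT.
have gP : (primal_obj mu q (graph_kernel q mT) <= Pq mu nu q)%E.
  by apply: ereal_sup_ubound; exists (graph_kernel q mT) => //; exists (graph_plan mu q mT).
have PD := Pq_le_Dq mu nu2 q2.
(* The cycle [Dq <= L cost <= primal_obj <= Pq <= Dq] closes, and [L cost] is a real number, whence
   finiteness. *)
have PL : Pq mu nu q = (L (@cost R d))%:E.
  by apply/eqP; rewrite eq_le (le_trans PD DL) (le_trans Lg gP).
split.
- exists (graph_plan mu q mT); split.
    exists (graph_kernel q mT); split => //.
    by apply/eqP; rewrite eq_le gP PL Lg.
  move=> pi k MTk kE; apply: (optimal_unique mu2 nu2 q2 qs mT oL gT MTk).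
  by rewrite kE PL.
- by rewrite PL.
- by apply/eqP; rewrite eq_le PD PL DL.
Qed.
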